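(* Let $V$ be an optimal prefix-free machine, and for real $T>0$ let $\Theta_V(T)=\sum_{s\in\{0,1\}^*,\,H_V(s)<|s|}2^{-|s|/T}$. For every $T\in(0,1)$, if $\Theta_V(T)$ is left-computable and $T$ is right-computable, then $T$ is $T$-compressible.
   Context: $\{0,1\}^*$ is the set of finite binary strings; $|s|$ is the length of $s$. A prefix-free machine is a partial recursive function $C:\{0,1\}^*\to\{0,1\}^*$ whose domain is prefix-free. $H_C(s)=\min\{|p| : C(p)=s\}$ (possibly $\infty$). A prefix-free machine $U$ is optimal if for every prefix-free machine $C$ there is $d\in\mathbb{N}$ such that for every $p\in\mathrm{Dom}\,C$ there is $q\in\mathrm{Dom}\,U$ with $U(q)=C(p)$ and $|q|\le|p|+d$. A particular optimal prefix-free machine $U$ is fixed and $H(s):=H_U(s)$. For a real $\alpha$ and $n\ge1$, $\alpha\restriction n$ denotes the first $n$ bits of the base-two expansion of $\alpha-\lfloor\alpha\rfloor$ (the expansion with infinitely many zeros). A real $\alpha$ is right-computable if there is a total recursive $f:\mathbb{N}^+\to\mathbb{Q}$ with $\alpha\le f(n)$ for all $n$ and $\lim_n f(n)=\alpha$; $\alpha$ is left-computable if $-\alpha$ is right-computable. For $T\in(0,1]$, $\alpha$ is $T$-compressible if $\limsup_{n\to\infty}H(\alpha\restriction n)/n\le T$. *)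

(* Defs.v *)
From HB Require Import structures.
From mathcomp Require Import all_boot all_order all_algebra.
From mathcomp Require Import all_classical all_reals all_analysis.
Set Implicit Arguments. Unset Strict Implicit. Unset Printing Implicit Defensive.
Import Order.TTheory GRing.Theory Num.Theory numFieldNormedType.Exports.
Local Open Scope ring_scope.
Local Open Scope classical_set_scope.

Inductive prog : Type :=
| Zero : prog
| Succ : prog
| Proj : nat -> prog
| Comp : prog -> seq prog -> prog
| Prec : prog -> prog -> prog
| Mu   : prog -> prog.

Inductive eval : prog -> seq nat -> nat -> Prop :=
| ev_zero l : eval Zero l 0
| ev_succ l : eval Succ l (head 0%N l).+1
| ev_proj i l : eval (Proj i) l (nth 0%N l i)
| ev_comp f gs l ys y : evals gs l ys -> eval f ys y -> eval (Comp f gs) l y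
| ev_prec0 f g l y : eval f l y -> eval (Prec f g) (0%N :: l) y
| ev_precS f g n l z y :
    eval (Prec f g) (n :: l) z -> eval g (n :: z :: l) y ->
    eval (Prec f g) (n.+1 :: l) y
| ev_mu f l n :
    eval f (n :: l) 0 ->
    (forall m, (m < n)%N -> exists k, eval f (m :: l) k.+1) ->
    eval (Mu f) l n
with evals : seq prog -> seq nat -> seq nat -> Prop :=
| evs_nil l : evals [::] l [::]
| evs_cons g gs l y ys : eval g l y -> evals gs l ys -> evals (g :: gs) l (y :: ys).

Definition computes (c : prog) (g : nat -> nat) : Prop :=
  forall n, eval c [:: n] (g n).
Definition total_recursive (g : nat -> nat) : Prop := exists c, computes c g.

(* Bijection {0,1}^* -> nat (bijective base-2 numeration). *)
Definition str2nat (s : seq bool) : nat :=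
  foldr (fun (b : bool) n => (2 * n + 1 + b)%N) 0%N s.

(* A machine (partial recursive function {0,1}^* -> {0,1}^* ) is given by a
   program; [runs C p s] means C(p) = s. *)
Definition runs (C : prog) (p s : seq bool) : Prop :=
  eval C [:: str2nat p] (str2nat s).
Definition halts (C : prog) (p : seq bool) : Prop := exists y, eval C [:: str2nat p] y.

Definition prefix_free (C : prog) : Prop :=
  forall p q, halts C p -> halts C q -> prefix p q -> p = q.

Definition optimal (U : prog) : Prop :=
  prefix_free U /\
  forall C, prefix_free C ->
    exists d : nat, forall p s, runs C p s ->
      exists q, runs U q s /\ (size q <= size p + d)%N.

(* H_C(s) = min {|p| : C(p) = s}, +oo if no such p *)
Definition Hc {R : realType} (C : prog) (s : seq bool) : \bar R :=
  ereal_inf [set ((size p)%:R)%:E | p in [set p | runs C p s]].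

(* i-th binary digit (i >= 1) of frac(x), expansion with infinitely many zeros *)
Definition bit {R : realType} (x : R) (i : nat) : bool :=
  odd `|Num.floor ((x - (Num.floor x)%:~R) * 2 ^+ i)|%N.
Definition restr {R : realType} (x : R) (n : nat) : seq bool :=
  [seq bit x i | i <- iota 1 n].

(* Computable sequences of rationals: q n = (a n - b n) / (c n + 1) with
   a, b, c total recursive. *)
Definition rat_seq {R : realType} (a b c : nat -> nat) (n : nat) : R :=
  ((a n)%:R - (b n)%:R) / ((c n).+1)%:R.

Definition right_computable {R : realType} (x : R) : Prop :=
  exists a b c : nat -> nat,
    [/\ total_recursive a, total_recursive b, total_recursive c,
        (forall n, x <= rat_seq a b c n) &
        rat_seq a b c n @[n --> \oo] --> x].

Definition left_computable {R : realType} (x : R) : Prop := right_computable (- x).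

Definition compressible {R : realType} (U : prog) (T x : R) : Prop :=
  (limn_esup (fun n => Hc U (restr x n.+1) * ((n.+1)%:R^-1)%:E) <= T%:E)%E.

Definition Theta {R : realType} (V : prog) (T : R) : \bar R :=
  esum [set s : seq bool | (Hc (R:=R) V s < ((size s)%:R)%:E)%E]
       (fun s => (powR 2 (- (size s)%:R / T))%:E).

(* Main.v *)
(* T is pinned down by a stage k at which almost all of the mass of Theta is
   known.  Let W_k be the strings s with H_V(s) < |s| found in k steps, S_k the sum
   of 2^-|s| over W_k (at most 1 by Kraft's inequality) and Theta_k(x) that of
   2^(-|s|/x).  Put m = T n.  A number e <= 2^m with S_k >= e/2^m for some k,
   but S_k' < (e+1)/2^m for all k', costs about m bits, and any k with
   S_k >= e/2^m misses mass less than 2^-m in S.  Each missed string then has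
   length at least m, so Theta(T) - Theta_k(T) <= 2^-m 2^(-m(1/T-1)) = 2^-n.
   Given k, search for j with Theta_k(t_j) <= w_j + 2^-n, where t_j >= T
   tends to T and w_j <= Theta(T) to Theta(T).  Then Theta_k(t_j) - Theta_k(T) is
   O(2^-n) and, W_k containing a fixed string, so is t_j - T; hence the first n
   bits of T are those of t_j up to a bounded correction, which selects one of
   finitely many machines.

   To have self-delimiting inputs without a logarithmic term, T is replaced by
   a rational B/B' slightly above it, with n = B' K + r and m = B K: the input
   1^K 0 x with |x| = B K + 1 has length (1 + B) K + 2, about (T + 2/B') n. *)

From Pilot Require Import Defs.
From HB Require Import structures.
From mathcomp Require Import all_boot all_order all_algebra.
From mathcomp Require Import all_classical all_reals all_analysis.
From mathcomp Require Import zify ring lra.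
Import Order.TTheory GRing.Theory Num.Theory numFieldNormedType.Exports.
(* MathComp's own [eval] would shadow that of [Defs]. *)
Import Pilot.Defs.
Set Implicit Arguments.
Unset Strict Implicit.
Local Open Scope ring_scope.

Local Open Scope nat_scope.

(** * Induction on programs and determinism of evaluation *)

Fixpoint all_prog (P : prog -> Prop) (gs : seq prog) : Prop :=
  if gs is g :: gs' then P g /\ all_prog P gs' else True.

(** The programs listed in [Comp] need induction hypotheses of their own; [all_prog] carries
    them. *)
Lemma prog_nested_ind (P : prog -> Prop) :
  P Zero -> P Succ -> (forall i, P (Proj i)) ->
  (forall f gs, P f -> all_prog P gs -> P (Comp f gs)) ->
  (forall f g, P f -> P g -> P (Prec f g)) ->
  (forall f, P f -> P (Mu f)) -> forall c, P c.
Proof.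
move=> h0 hs hi hc hp hm; fix IH 1; case.
- exact: h0.
- exact: hs.
- exact: hi.
- move=> f gs; apply: hc; first exact: IH.
  by elim: gs => //=.
- by move=> f g; apply: hp; exact: IH.
- by move=> f; apply: hm; exact: IH.
Qed.

Lemma eval_comp_inv f gs l y :
  eval (Comp f gs) l y -> exists2 ys, evals gs l ys & eval f ys y.
Proof. by move=> h; inversion h; subst; exists ys. Qed.

Lemma evals_cons_inv g gs l ys : evals (g :: gs) l ys ->
  exists z zs, [/\ ys = z :: zs, eval g l z & evals gs l zs].
Proof. by move=> h; inversion h; subst; do 2!eexists; split. Qed.

Lemma evals_nil_inv l ys : evals [::] l ys -> ys = [::].
Proof. by move=> h; inversion h. Qed.

Lemma eval_prec0_inv f g l y : eval (Prec f g) (0 :: l) y -> eval f l y.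
Proof. by move=> h; inversion h. Qed.

Lemma eval_precS_inv f g n l y : eval (Prec f g) (n.+1 :: l) y ->
  exists2 z, eval (Prec f g) (n :: l) z & eval g (n :: z :: l) y.
Proof. by move=> h; inversion h; subst; exists z. Qed.

Lemma eval_mu_inv f l n : eval (Mu f) l n -> eval f (n :: l) 0 /\
  (forall m, m < n -> exists k, eval f (m :: l) k.+1).
Proof. by move=> h; inversion h. Qed.

Lemma eval_fun c l y y' : eval c l y -> eval c l y' -> y = y'.
Proof.
move: c l y y'; apply: prog_nested_ind.
- by move=> l y y' h h'; inversion h; inversion h'.
- by move=> l y y' h h'; inversion h; inversion h'.
- by move=> i l y y' h h'; inversion h; inversion h'.
- move=> f gs IHf IHgs l y y' /eval_comp_inv[ys hs h] /eval_comp_inv[zs hs' h'].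
  suff E : ys = zs by apply: IHf h _; rewrite E.
  elim: gs ys zs IHgs hs hs' {h h'} => [|g gs IH] ys zs /=.
    by move=> _ /evals_nil_inv -> /evals_nil_inv ->.
  move=> [hg /IH{}IH] /evals_cons_inv[z [{}ys [-> hz hs]]].
  move=> /evals_cons_inv[z' [{}zs [-> hz' hs']]].
  by rewrite (hg _ _ _ hz hz') (IH _ _ hs hs').
- move=> f g IHf IHg [|n l] y y' h; first by inversion h.
  elim: n y y' h => [|n IH] y y'.
    by move=> /eval_prec0_inv h /eval_prec0_inv; apply: IHf.
  move=> /eval_precS_inv[z hz h] /eval_precS_inv[z' hz' h'].
  by rewrite (IH _ _ hz hz') in h; apply: IHg h h'.
- move=> f IH l y y' /eval_mu_inv[h0 hlt] /eval_mu_inv[h0' hlt'].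
  (* Were one result smaller, the other evaluation would give a positive value where the first gives
     0. *)
  case: (ltngtP y y') => // hn.
    by case: (hlt' _ hn) => k hk; have := IH _ _ _ h0 hk.
  by case: (hlt _ hn) => k hk; have := IH _ _ _ h0' hk.
Qed.

(** * Recursive functions *)

(** [F] has to be computed only on lists of length [k], so it can read its arguments by [nth],
    [head] and [drop]. *)
Definition recf k (F : seq nat -> nat) :=
  exists c, forall l, size l = k -> eval c l (F l).
Definition recfs k m (G : seq nat -> seq nat) :=
  exists gs, forall l, size l = k -> size (G l) = m /\ evals gs l (G l).

Lemma recf_ext k F G :
  (forall l, size l = k -> F l = G l) -> recf k F -> recf k G.
Proof. by move=> FG [c hc]; exists c => l hl; rewrite -FG //; apply: hc. Qed.

Lemma recfs_ext k m F G :
  (forall l, size l = k -> F l = G l) -> recfs k m F -> recfs k m G.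
Proof. by move=> FG [c hc]; exists c => l hl; rewrite -FG //; apply: hc. Qed.

Lemma recfs_nil k : recfs k 0 (fun=> [::]).
Proof. by exists [::] => l _; split=> //; constructor. Qed.

Lemma recfs_cons k m F G :
  recf k F -> recfs k m G -> recfs k m.+1 (fun l => F l :: G l).
Proof.
move=> [c hc] [gs hgs]; exists (c :: gs) => l hl.
by case: (hgs l hl) => <- h; split => //; constructor => //; apply: hc.
Qed.

Lemma recf_comp k m F G : recf m F -> recfs k m G -> recf k (fun l => F (G l)).
Proof.
move=> [c hc] [gs hgs]; exists (Comp c gs) => l hl.
by case: (hgs l hl) => hs he; apply: (ev_comp he); apply: hc.
Qed.

Lemma recf_nth k i : recf k (fun l => nth 0 l i).
Proof. by exists (Proj i) => l _; constructor. Qed.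

Lemma recfs_drop k i : recfs k (k - i) (drop i).
Proof.
move: {2}(k - i) (erefl (k - i)) => d hd; rewrite hd.
elim: d i hd => [|d IH] i hd.
  apply: recfs_ext (recfs_nil k) => l hl; rewrite drop_oversize // hl.
  by rewrite -subn_eq0 hd.
apply: recfs_ext (recfs_cons (recf_nth k i) (IH i.+1 _)); last by rewrite subnS hd.
by move=> l hl; rewrite -drop_nth // hl -subn_gt0 hd.
Qed.

Lemma recfs_tail d k : recfs (d + k) k (drop d).
Proof. by have := recfs_drop (d + k) d; rewrite addKn. Qed.

Lemma recf_tail d k F : recf k F -> recf (d + k) (fun l => F (drop d l)).
Proof. by move=> hF; apply: (recf_comp hF); apply: recfs_tail. Qed.

Lemma recf_const k n : recf k (fun=> n).
Proof.
elim: n => [|n [c hc]]; first by exists Zero => l _; constructor.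
exists (Comp Succ [:: c]) => l hl.
apply: (@ev_comp _ _ _ [:: n]); last exact: (ev_succ [:: n]).
by constructor; [exact: hc | constructor].
Qed.

Lemma recf_prec k F G : recf k F -> recf k.+2 G ->
  recf k.+1 (fun l => iteri (head 0 l) (fun n z => G (n :: z :: behead l))
                       (F (behead l))).
Proof.
move=> [f hf] [g hg]; exists (Prec f g) => -[//|n l] /= [hl].
elim: n => [|n IH]; first by constructor; apply: hf.
by apply: ev_precS IH _; apply: hg; rewrite /= hl.
Qed.

Lemma recf_succ k F : recf k F -> recf k (fun l => (F l).+1).
Proof.
move=> [c hc]; exists (Comp Succ [:: c]) => l hl.
apply: (@ev_comp _ _ _ [:: F l]); last exact: (ev_succ [:: F l]).
by constructor; [exact: hc | constructor].
Qed.

Lemma recf_iter k N F G : recf k N -> recf k F -> recf k.+2 G ->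
  recf k (fun l => iteri (N l) (fun n z => G (n :: z :: l)) (F l)).
Proof.
move=> hN hF hG.
apply: recf_ext (recf_comp (recf_prec hF hG) (recfs_cons hN (recfs_tail 0 k))).
by move=> l hl; rewrite drop0.
Qed.

Lemma recf_iter_snd k N F (s : nat -> nat) : recf k N -> recf k F ->
  recf 1 (fun l => s (head 0 l)) -> recf k (fun l => iter (N l) s (F l)).
Proof.
move=> hN hF hs.
have hG : recf k.+2 (fun l => s (nth 0 l 1)).
  exact: (recf_comp hs (recfs_cons (recf_nth _ 1) (recfs_nil _))).
apply: recf_ext (recf_iter hN hF hG) => l _ /=.
by elim: (N l) => //= n ->.
Qed.

Lemma recf1_succ : recf 1 (fun l => (head 0 l).+1).
Proof. by exists Succ => l _; constructor. Qed.

Lemma recf_add k F G : recf k F -> recf k G -> recf k (fun l => F l + G l).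
Proof.
move=> hF hG; apply: recf_ext (recf_iter_snd hF hG recf1_succ) => l _.
by rewrite iter_succn addnC.
Qed.

Lemma recf1_pred : recf 1 (fun l => (head 0 l).-1).
Proof.
have := recf_iter (recf_nth 1 0) (recf_const 1 0) (recf_nth 3 0).
apply: recf_ext => -[//|n l] _ /=.
by case: n.
Qed.

Lemma recf_sub k F G : recf k F -> recf k G -> recf k (fun l => F l - G l).
Proof.
move=> hF hG; apply: recf_ext (recf_iter_snd hG hF recf1_pred) => l _.
by elim: (G l) => [|n /= ->]; rewrite ?subn0 ?subnS.
Qed.

Lemma recf_mul k F G : recf k F -> recf k G -> recf k (fun l => F l * G l).
Proof.
move=> hF hG.
have := recf_iter hF (recf_const k 0) (recf_add (recf_nth _ 1) (recf_tail 2 hG)).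
apply: recf_ext => l _ /=; rewrite drop0.
by elim: (F l) => //= n ->; rewrite mulSn addnC.
Qed.

Lemma recf_exp k F G : recf k F -> recf k G -> recf k (fun l => F l ^ G l).
Proof.
move=> hF hG.
have := recf_iter hG (recf_const k 1) (recf_mul (recf_nth _ 1) (recf_tail 2 hF)).
apply: recf_ext => l _ /=; rewrite drop0.
by elim: (G l) => //= n ->; rewrite expnSr.
Qed.

Lemma recf_leq k F G : recf k F -> recf k G -> recf k (fun l => F l <= G l).
Proof.
move=> hF hG; have := recf_sub (recf_const k 1) (recf_sub hF hG).
by apply: recf_ext => l _; rewrite /leq; case: (F l - G l).
Qed.

Lemma recf_eq k F G : recf k F -> recf k G -> recf k (fun l => F l == G l).
Proof.
move=> hF hG; have := recf_mul (recf_leq hF hG) (recf_leq hG hF).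
by apply: recf_ext => l _; rewrite mulnb -eqn_leq.
Qed.

Lemma recf_sum k N G : recf k N -> recf k.+1 G ->
  recf k (fun l => \sum_(i < N l) G ((i : nat) :: l)).
Proof.
move=> hN hG.
have hG2 : recf k.+2 (fun l => nth 0 l 1 + G (head 0 l :: drop 2 l)).
  apply: recf_add; first exact: recf_nth.
  exact: (recf_comp hG (recfs_cons (recf_nth k.+2 0) (recfs_tail 2 k))).
have := recf_iter hN (recf_const k 0) hG2.
apply: recf_ext => l _ /=; rewrite drop0.
elim: (N l) => [|n /= ->]; first by rewrite big_ord0.
by rewrite big_ord_recr.
Qed.

(** Quotients, lengths and roots are written as the number of indices that pass a test, since
    bounded sums stay recursive. *)
Lemma sum_threshold (P : pred nat) n e : e <= n ->
  (forall i, i < n -> P i = (i < e)) -> \sum_(i < n) P i = e.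
Proof.
move=> he hP; rewrite -[RHS]card_ord -sum1_card.
rewrite (big_ord_widen n (fun=> 1) he) [RHS]big_mkcond /=.
by apply: eq_bigr => i _; rewrite hP //; case: ifP.
Qed.

Lemma divn_sum m d : 0 < d -> \sum_(x < m) (x.+1 * d <= m) = m %/ d.
Proof.
move=> hd; apply: (@sum_threshold (fun x => x.+1 * d <= m)) => [|i _].
  exact: leq_div.
by rewrite leq_divRL.
Qed.

Lemma recf_div k F G : recf k F -> recf k G -> recf k (fun l => F l %/ (G l).+1).
Proof.
move=> hF hG.
have := recf_sum hF (recf_leq
  (recf_mul (recf_succ (recf_nth _ 0)) (recf_succ (recf_tail 1 hG))) (recf_tail 1 hF)).
apply: recf_ext => l _ /=; rewrite drop0 -divn_sum //.
Qed.

(* Arithmetic expressions with de Bruijn variables; [Opq F] is an arbitrary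
   function of the environment and [Sum e f] binds the variable 0 of [f]. *)
Inductive ex :=
| Var of nat | Cst of nat | Opq of (seq nat -> nat)
| Add of ex & ex | Sub of ex & ex | Mul of ex & ex | Exp of ex & ex
| Leq of ex & ex | Eqn of ex & ex | Div of ex & ex
| Fn1 of (nat -> nat) & ex | Fn2 of (nat -> nat -> nat) & ex & ex
| Sum of ex & ex.

Fixpoint den (e : ex) (l : seq nat) : nat :=
  match e with
  | Var i => nth 0 l i
  | Cst n => n
  | Opq F => F l
  | Add a b => den a l + den b l
  | Sub a b => den a l - den b l
  | Mul a b => den a l * den b l
  | Exp a b => den a l ^ den b l
  | Leq a b => den a l <= den b l
  | Eqn a b => den a l == den b l
  | Div a b => den a l %/ (den b l).+1
  | Fn1 f a => f (den a l)
  | Fn2 f a b => f (den a l) (den b l)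
  | Sum a b => \sum_(i < den a l) den b ((i : nat) :: l)
  end.

Fixpoint wfe (k : nat) (e : ex) : Prop :=
  match e with
  | Var _ | Cst _ => True
  | Opq F => recf k F
  | Add a b | Sub a b | Mul a b | Exp a b | Leq a b | Eqn a b | Div a b =>
      wfe k a /\ wfe k b
  | Fn1 f a => recf 1 (fun l => f (nth 0 l 0)) /\ wfe k a
  | Fn2 f a b => recf 2 (fun l => f (nth 0 l 0) (nth 0 l 1)) /\ (wfe k a /\ wfe k b)
  | Sum a b => wfe k a /\ wfe k.+1 b
  end.

Lemma recf_ex k e : wfe k e -> recf k (den e).
Proof.
elim: e k => //=; intros;
  repeat match goal with H : _ /\ _ |- _ => case: H => * end.
- exact: recf_nth.
- exact: recf_const.
- by apply: recf_add; auto.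
- by apply: recf_sub; auto.
- by apply: recf_mul; auto.
- by apply: recf_exp; auto.
- by apply: recf_leq; auto.
- by apply: recf_eq; auto.
- by apply: recf_div; auto.
- apply: (@recf_comp _ 1 (fun l => n (nth 0 l 0)) (fun l => [:: den e l])) => //.
  by apply: recfs_cons; [auto | exact: recfs_nil].
- apply: (@recf_comp _ 2 (fun l => n (nth 0 l 0) (nth 0 l 1))
            (fun l => [:: den e l; den e0 l])) => //.
  by do 2!(apply: recfs_cons; first auto); exact: recfs_nil.
- by apply: recf_sum; auto.
Qed.

(** * Evaluation with bounded fuel *)

(* [F (t :: l)] is y.+1 if [c] is found to return y on [l] with fuel [t], and 0 if
   no value is found. *)
Definition approximates k c F :=
  [/\ recf k.+1 F,
      forall t l y, size l = k -> F (t :: l) = y.+1 -> eval c l y &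
      forall l y, size l = k -> eval c l y ->
        exists t0, forall t, t0 <= t -> F (t :: l) = y.+1].

(** A positive [ok] signals that every program of the list has answered within the fuel; only then
    is [Y] meaningful. *)
Definition approximates_seq k gs Y ok :=
  [/\ recfs k.+1 (size gs) Y, recf k.+1 ok,
      forall t l, size l = k -> 0 < ok (t :: l) -> evals gs l (Y (t :: l)) &
      forall l ys, size l = k -> evals gs l ys ->
        exists t0, forall t, t0 <= t -> 0 < ok (t :: l) /\ Y (t :: l) = ys].

Lemma approximates_seq_exists k gs :
  all_prog (fun c => forall k, exists F, approximates k c F) gs ->
  exists Y ok, approximates_seq k gs Y ok.
Proof.
elim: gs => [_|g gs IH /= [/(_ k)[F [rF sF cF]] /IH[Y [ok [rY rok sY cY]]]]].
  exists (fun=> [::]), (fun=> 1); split => //.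
  - exact: recfs_nil.
  - exact: recf_const.
  - by move=> *; constructor.
  - by move=> l ys _ /evals_nil_inv ->; exists 0.
exists (fun l => (F l).-1 :: Y l), (fun l => (0 < F l) * ok l); split.
- apply: recfs_cons => //.
  exact: (recf_comp recf1_pred (recfs_cons rF (recfs_nil _))).
- by apply: recf_mul => //; apply: recf_leq => //; apply: recf_const.
- move=> t l hl; rewrite muln_gt0 lt0b => /andP[hF hok].
  by constructor; [apply: (sF t) => //; rewrite prednK | apply: sY].
- move=> l ys hl /evals_cons_inv[z [zs [-> hz hzs]]].
  case: (cF _ _ hl hz) => t0 h0; case: (cY _ _ hl hzs) => t1 h1.
  exists (maxn t0 t1) => t; rewrite geq_max => /andP[/h0 -> /h1[ok1 ->]].
  by rewrite mul1n.
Qed.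

Lemma approximates_comp k f gs F Y ok :
  approximates (size gs) f F -> approximates_seq k gs Y ok ->
  approximates k (Comp f gs) (fun l => (0 < ok l) * F (head 0 l :: Y l)).
Proof.
move=> [rF sF cF] [rY rok sY cY]; split.
- apply: recf_mul; first by apply: recf_leq => //; apply: recf_const.
  exact: (recf_comp rF (recfs_cons (recf_nth _ 0) rY)).
- move=> t l y hl /=; case: (ltnP 0 (ok (t :: l))) => // h; rewrite mul1n => hF.
  have hY := sY _ _ hl h; apply: (ev_comp hY); apply: sF hF.
  by case: rY => ? /(_ (t :: l)); rewrite /= hl => /(_ erefl)[].
- move=> l y hl /eval_comp_inv[ys hys hy].
  case: (cY _ _ hl hys) => t0 h0.
  have sys : size ys = size gs.
    have [_ <-] := h0 _ (leqnn t0).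
    by case: rY => ? /(_ (t0 :: l)); rewrite /= hl => /(_ erefl)[].
  case: (cF _ _ sys hy) => t1 h1.
  exists (maxn t0 t1) => t; rewrite geq_max => /andP[/h0[-> -> /=] /h1 ->].
  by rewrite mul1n.
Qed.

(** The iteration carries the value plus one; the factor [0 < z] lets a missing value, coded by 0,
    persist to the end. *)
Lemma approximates_prec k f g F G :
  approximates k f F -> approximates k.+2 g G ->
  approximates k.+1 (Prec f g) (fun l =>
    iteri (nth 0 l 1) (fun n z => (0 < z) * G (nth 0 l 0 :: n :: z.-1 :: drop 2 l))
      (F (nth 0 l 0 :: drop 2 l))).
Proof.
move=> [rF sF cF] [rG sG cG]; split.
- have r2 : recfs k.+2 k (drop 2) := recfs_tail 2 k.
  apply: (@recf_iter _ _ _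
    (fun l => (0 < nth 0 l 1) *
       G (nth 0 l 2 :: nth 0 l 0 :: (nth 0 l 1).-1 :: drop 4 l))).
  + exact: recf_nth.
  + exact: (recf_comp rF (recfs_cons (recf_nth _ 0) r2)).
  + apply: recf_mul; first by apply: recf_leq; [exact: recf_const|exact: recf_nth].
    apply: (recf_comp rG); do 2!(apply: recfs_cons; first exact: recf_nth).
    apply: recfs_cons; last exact: (recfs_tail 4 k).
    exact: (recf_comp recf1_pred (recfs_cons (recf_nth _ 1) (recfs_nil _))).
- move=> t [//|n l] y [hl] /=; rewrite drop0.
  elim: n y => [|n IH] y /=; first by move/(sF _ _ _ hl) => ?; constructor.
  case: (iteri _ _ _) IH => [|z] IH; rewrite ?mul0n ?mul1n //= => hG.
  by apply: (ev_precS (IH _ erefl)); apply: sG hG; rewrite /= hl.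
- move=> [//|n l] y [hl]; elim: n y => [|n IH] y.
    move=> /eval_prec0_inv /(cF _ _ hl)[t0 h0]; exists t0 => t /h0 /=.
    by rewrite drop0.
  move=> /eval_precS_inv[z /IH[t0 h0] hy].
  have [|t1 h1] := cG _ _ _ hy; first by rewrite /= hl.
  exists (maxn t0 t1) => t; rewrite geq_max => /andP[/h0 /= -> /h1 /=].
  by rewrite drop0 mul1n.
Qed.

Lemma sum_pick t (g : nat -> nat) (P : pred nat) n : n < t -> P n ->
  (forall m, m < t -> P m -> m = n) -> \sum_(i < t) g i * P i = g n.
Proof.
move=> hn Pn hu; rewrite (bigD1 (Ordinal hn)) //= Pn muln1 big1 ?addn0 // => i.
move=> /eqP hi; case: (boolP (P i)) => [Pi|_]; last by rewrite muln0.
by case: hi; apply: val_inj; rewrite /= (hu i).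
Qed.

(** In [q], 0 codes no answer, 1 the value 0, and more a positive value; so [n] is a confirmed
    result of minimization. *)
Definition first_one (q : nat -> nat) n :=
  (q n == 1) && (\sum_(m < n) (q m <= 1) == 0).

Lemma first_oneP q n :
  reflect (q n == 1 /\ forall m, m < n -> 1 < q m) (first_one q n).
Proof.
rewrite /first_one; case: (q n == 1) => /=; last by constructor => -[].
rewrite sum_nat_eq0; apply: (iffP forall_inP) => [H|[_ H] m].
  by split=> // m hm; have := H (Ordinal hm) isT; rewrite /= eqb0 -ltnNge.
by move=> _; rewrite eqb0 -ltnNge H.
Qed.

Lemma first_one_inj q n m : first_one q n -> first_one q m -> n = m.
Proof.
move=> /first_oneP[/eqP hn Hn] /first_oneP[/eqP hm Hm].
by case: (ltngtP n m) => // [/Hm|/Hn]; rewrite ?hn ?hm.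
Qed.

Lemma approximates_mu k f F :
  approximates k.+1 f F ->
  approximates k (Mu f) (fun l =>
    \sum_(n < head 0 l) (n.+1 * first_one (fun m => F (head 0 l :: m :: behead l)) n)).
Proof.
move=> [rF sF cF]; split.
- have r3 : recf k.+3 (fun l => F (nth 0 l 2 :: nth 0 l 0 :: drop 3 l)).
    apply: (recf_comp rF); do 2!(apply: recfs_cons; first exact: recf_nth).
    exact: (recfs_tail 3 k).
  have r2 : recf k.+2 (fun l => F (nth 0 l 1 :: nth 0 l 0 :: drop 2 l)).
    apply: (recf_comp rF); do 2!(apply: recfs_cons; first exact: recf_nth).
    exact: (recfs_tail 2 k).
  have : wfe k.+1 (Sum (Var 0) (Mul (Add (Var 0) (Cst 1)) (Mul
    (Eqn (Opq (fun l => F (nth 0 l 1 :: nth 0 l 0 :: drop 2 l))) (Cst 1))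
    (Eqn (Sum (Var 0) (Leq (Opq (fun l => F (nth 0 l 2 :: nth 0 l 0 :: drop 3 l))) (Cst 1)))
       (Cst 0))))) by [].
  move=> /recf_ex; apply: recf_ext => -[//|t l] _ /=; rewrite /first_one.
  by apply: eq_bigr => n _; rewrite addn1 !drop0 mulnb.
- move=> t l y hl /=; set q := fun n => F (t :: n :: l).
  case: (boolP [exists n : 'I_t, first_one q n]) => [/existsP[n hn]|/existsPn hN].
    rewrite (@sum_pick _ succn (first_one q) n) // => [[<-]|m _ hm]; last first.
      exact: first_one_inj hm hn.
    have [/eqP h1 h2] := first_oneP _ _ hn.
    apply: ev_mu; first by apply: sF h1; rewrite /= hl.
    move=> m /h2 hm; exists (q m).-2; apply: (sF t); first by rewrite /= hl.
    by rewrite -/(q m); case: (q m) hm => [|[]].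
  by rewrite big1 // => n _; rewrite (negbTE (hN n)) muln0.
- move=> l y hl /eval_mu_inv[h0 hlt].
  have hsz n : size (n :: l) = k.+1 by rewrite /= hl.
  have [t0 ht0] := cF _ _ (hsz y) h0.
  (* Only finitely many [m] lie below [y], so one amount of fuel settles them all. *)
  have [t1 ht1] : exists t1, forall t, t1 <= t -> forall m, m < y -> 1 < F (t :: m :: l).
    elim: y hlt {h0 ht0} => [|y IH] hlt; first by exists 0.
    case: IH => [m hm|t1 ht1]; first exact/hlt/ltnW.
    have [z /(cF _ _ (hsz y))[t2 ht2]] := hlt y (leqnn _).
    exists (maxn t1 t2) => t; rewrite geq_max => /andP[le1 le2] m.
    by rewrite ltnS leq_eqVlt => /orP[/eqP->|]; [rewrite ht2|apply: ht1].
  (* The fuel must also exceed [y], because candidates are tried only below the fuel. *)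
  exists (maxn y.+1 (maxn t0 t1)) => t; rewrite !geq_max => /and3P[hy le0 le1] /=.
  have hP : first_one (fun n => F (t :: n :: l)) y.
    apply/first_oneP; split; first by rewrite ht0.
    by move=> m; apply: ht1.
  rewrite (@sum_pick _ succn (first_one (fun n => F (t :: n :: l))) y) // => m _ hm.
  exact: first_one_inj hm hP.
Qed.

Lemma approximates_exists c k : exists F, approximates k c F.
Proof.
move: c k; apply: prog_nested_ind.
- move=> k; exists (fun=> 1); split; first exact: recf_const.
  + by move=> t l y _ [<-]; constructor.
  + by move=> l y _ h; inversion h; exists 0.
- move=> k; exists (fun l => (nth 0 l 1).+2); split.
  + by do 2!apply: recf_succ; apply: recf_nth.
  + by move=> t l y _ [<-]; rewrite /= nth0; constructor.
  + by move=> l y _ h; inversion h; exists 0 => t _ /=; rewrite nth0.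
- move=> i k; exists (fun l => (nth 0 l i.+1).+1); split.
  + by apply: recf_succ; apply: recf_nth.
  + by move=> t l y _ [<-] /=; constructor.
  + by move=> l y _ h; inversion h; exists 0.
- move=> f gs /(_ (size gs))[F hF] /(@approximates_seq_exists) hgs k.
  have [Y [ok hY]] := hgs k.
  by eexists; apply: approximates_comp hF hY.
- move=> f g hf hg [|k].
    (* [Prec] has no evaluation on the empty list, so the approximation that never answers is
       right. *)
    exists (fun=> 0); split; [exact: recf_const|by []|].
    by move=> l y /size0nil -> h; inversion h.
  case: (hf k) => F hF; case: (hg k.+2) => G hG.
  by eexists; apply: approximates_prec hF hG.
- by move=> f hf k; case: (hf k.+1) => F hF; eexists; apply: approximates_mu hF.
Qed.

(** * Strings and prefix-free machines *)

Lemma str2nat_cons b s : str2nat (b :: s) = 2 * str2nat s + 1 + b.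
Proof. by []. Qed.

Lemma str2nat_inj : injective str2nat.
Proof.
elim=> [|b s IH] [|b' s'] //; rewrite ?str2nat_cons ?[str2nat [::]]/=; try lia.
move=> h; have : b = b' /\ str2nat s = str2nat s' by case: b b' h => -[]; lia.
by case=> -> /IH ->.
Qed.

Lemma str2nat_surj n : exists s, str2nat s = n.
Proof.
elim/ltn_ind: n => -[|n] IH; first by exists [::].
have [|s hs] := IH n./2; first by lia.
by exists (odd n :: s); rewrite str2nat_cons hs; lia.
Qed.

Lemma str2nat_bounds s : 2 ^ size s <= (str2nat s).+1 < 2 ^ (size s).+1.
Proof.
elim: s => // b s; rewrite str2nat_cons -[size (b :: s)]/(size s).+1 !expnS => /andP[h1 h2].
by case: b; apply/andP; split; lia.
Qed.

(** The integer part of the binary logarithm of n + 1, which is the length of the string numbered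
    [n]. *)
Definition codelen n := \sum_(i < n) (2 ^ i.+1 <= n.+1).

Lemma codelen_str2nat s : codelen (str2nat s) = size s.
Proof.
have /andP[h1 h2] := str2nat_bounds s.
apply: (@sum_threshold (fun i => 2 ^ i.+1 <= (str2nat s).+1)) => [|i _].
  by rewrite -ltnS; apply: leq_trans h1; apply: ltn_expl.
apply/idP/idP => [h|h]; last by apply: leq_trans h1; rewrite leq_exp2l.
by have := leq_ltn_trans h h2; rewrite ltn_exp2l.
Qed.

Lemma codelen_bounds n : 2 ^ codelen n <= n.+1 < 2 ^ (codelen n).+1.
Proof. by have [s <-] := str2nat_surj n; rewrite codelen_str2nat str2nat_bounds. Qed.

Lemma codelen_le n : codelen n <= n.
Proof.
have /andP[h _] := codelen_bounds n.
by rewrite -ltnS; apply: leq_trans h; apply: ltn_expl.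
Qed.

Lemma codelen_eq n k : 2 ^ k <= n.+1 < 2 ^ k.+1 -> codelen n = k.
Proof.
move=> /andP[h1 h2]; have /andP[h3 h4] := codelen_bounds n.
have := leq_ltn_trans h1 h4; have := leq_ltn_trans h3 h2.
by rewrite !ltn_exp2l // !ltnS => *; apply/eqP; rewrite eqn_leq; apply/andP.
Qed.

Lemma recf_codelen : recf 1 (fun l => codelen (nth 0 l 0)).
Proof.
have : wfe 1 (Sum (Var 0) (Leq (Exp (Cst 2) (Add (Var 0) (Cst 1))) (Add (Var 1) (Cst 1)))) by [].
move=> /recf_ex; apply: recf_ext => -[//|n l] _ /=.
by apply: eq_bigr => i _; rewrite !addn1.
Qed.

(** * Self-delimiting inputs *)

Definition header K x := nseq K true ++ false :: x.

Lemma size_header K x : size (header K x) = K + 1 + size x.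
Proof. by rewrite size_cat size_nseq /= -addnA. Qed.

(** Prepending a 1 doubles [str2nat] plus 2, whence the shift by two and the factor 2^K. *)
Lemma str2nat_header K x :
  (str2nat (header K x)).+2 = 2 ^ K * (2 * (str2nat x).+1).+1.
Proof.
elim: K => [|K IH]; first by rewrite str2nat_cons; lia.
by rewrite -[header _ _]/(true :: header K x) str2nat_cons expnS -mulnA -IH; lia.
Qed.

Lemma header_prefix K x K' x' : prefix (header K x) (header K' x') ->
  K = K' /\ prefix x x'.
Proof.
by elim: K K' => [|K IH] [|K'] //= h; have [-> ->] := IH _ h.
Qed.

(** By [str2nat_header], [N] is then the number of 1^K 0 x with [(str2nat x).+1 = 2 ^ L K + a], so
    that [a] is the rank of [x] among the strings of length [L K]. *)
Definition parse (L : nat -> nat) N K a :=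
  (N.+2 == 2 ^ K * (2 * (2 ^ L K + a)).+1) && (a < 2 ^ L K).

Lemma payload_exists n a : a < 2 ^ n ->
  exists2 x, size x = n & (str2nat x).+1 = 2 ^ n + a.
Proof.
move=> ha; have h0 : 0 < 2 ^ n by rewrite expn_gt0.
have [x hx] := str2nat_surj (2 ^ n + a).-1.
have hx' : (str2nat x).+1 = 2 ^ n + a by rewrite hx prednK // addn_gt0 h0.
exists x => //; rewrite -codelen_str2nat; apply: codelen_eq.
by rewrite hx' leq_addr /= expnS; lia.
Qed.

Lemma parse_header L N K a : parse L N K a ->
  exists x, size x = L K /\ N = str2nat (header K x).
Proof.
move=> /andP[/eqP hN /payload_exists[x sx hx]]; exists x; split=> //.
by apply/eqP; rewrite -eqSS -eqSS hN str2nat_header hx.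
Qed.

Lemma parse_inj L N K a K' a' :
  parse L N K a -> parse L N K' a' -> K = K' /\ a = a'.
Proof.
move=> h h'; have [x [sx E]] := parse_header h; have [x' [sx' E']] := parse_header h'.
have : header K x = header K' x' by apply: str2nat_inj; rewrite -E.
move=> hh; have [] := @header_prefix K x K' x'; first by rewrite hh prefix_refl.
move=> eK _; subst K'; split=> //.
move: h h'; rewrite /parse => /andP[/eqP-> _] /andP[]; rewrite eqn_pmul2l ?expn_gt0 //.
by move=> /eqP; lia.
Qed.

(** Allows the search for [K] and [a] to be bounded by [N]. *)
Lemma parse_lt L N K a : parse L N K a -> (K < N) && (a < N).
Proof.
move=> /andP[/eqP hN _]; have hK : K < 2 ^ K by apply: ltn_expl.
have h0 : 0 < 2 ^ L K by rewrite expn_gt0.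
have : 2 ^ K * 3 <= N.+2 by rewrite hN leq_mul2l; apply/orP; right; lia.
have : (2 * (1 + a)).+1 <= N.+2.
  by rewrite hN; apply: (@leq_trans (2 * (2 ^ L K + a)).+1); [lia|rewrite leq_pmull ?expn_gt0].
by move=> *; apply/andP; split; lia.
Qed.

Lemma parse_exists L K a : a < 2 ^ L K ->
  exists p, size p = K + 1 + L K /\ parse L (str2nat p) K a.
Proof.
move=> ha; have [x sx hx] := payload_exists ha.
by exists (header K x); rewrite size_header /parse str2nat_header hx eqxx ha sx.
Qed.

Lemma sum_pick2 t (g : nat -> nat -> nat) (P : nat -> nat -> bool) m n :
  m < t -> n < t -> P m n ->
  (forall i j, P i j -> i = m /\ j = n) ->
  \sum_(i < t) \sum_(j < t) g i j * P i j = g m n.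
Proof.
move=> hm hn Pmn hu; rewrite (bigD1 (Ordinal hm)) //= (@sum_pick t (g m) (P m) n) //.
  rewrite big1 ?addn0 // => i /eqP hi; rewrite big1 // => j _.
  case: (boolP (P i j)) => [/hu[ei _]|_]; last by rewrite muln0.
  by case: hi; apply: val_inj.
by move=> j _ /hu[].
Qed.

(* The inputs are 1^K 0 x with x of length L K; as K determines the length of
   the input, the domain is prefix-free. *)
Lemma header_machine (L : nat -> nat) (D : prog) :
  recf 1 (fun l => L (nth 0 l 0)) ->
  exists2 C, prefix_free C & forall K a z, a < 2 ^ L K ->
    eval D [:: K; a; 0] z ->
    exists p, size p = K + 1 + L K /\ eval C [:: str2nat p] z.
Proof.
move=> recL.
pose pe i := Mul (Eqn (Add (Var i) (Cst 2)) (Mul (Exp (Cst 2) (Var 1))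
   (Add (Mul (Cst 2) (Add (Exp (Cst 2) (Fn1 L (Var 1))) (Var 0))) (Cst 1))))
   (Leq (Add (Var 0) (Cst 1)) (Exp (Cst 2) (Fn1 L (Var 1)))).
have dpe i l : den (pe i) l = parse L (nth 0 l i) (nth 0 l 1) (nth 0 l 0).
  by rewrite /= /parse mulnb addn2 !addn1.
pose eK := Sum (Var 0) (Sum (Var 1) (Mul (Var 1) (pe 2))).
pose eA := Sum (Var 0) (Sum (Var 1) (Mul (Var 0) (pe 2))).
(* The value of [eG] ignores the search variable and is 0 exactly when the input parses, so [Mu cG]
   returns 0 or diverges; this cuts the domain down to the parsable inputs. *)
pose eG := Eqn (Sum (Var 1) (Sum (Var 2) (pe 3))) (Cst 0).
have eKE N : den eK [:: N] = \sum_(i < N) \sum_(j < N) i * parse L N i j.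
  apply: eq_bigr => i _; apply: eq_bigr => j _.
  exact: (congr1 (muln _) (dpe 2 [:: (j : nat); (i : nat); N])).
have eAE N : den eA [:: N] = \sum_(i < N) \sum_(j < N) j * parse L N i j.
  apply: eq_bigr => i _; apply: eq_bigr => j _.
  exact: (congr1 (muln _) (dpe 2 [:: (j : nat); (i : nat); N])).
have eGE m N : den eG [:: m; N] = (\sum_(i < N) \sum_(j < N) parse L N i j == 0).
  rewrite /eG [LHS]/=; congr (nat_of_bool (_ == 0)).
  by apply: eq_bigr => i _; apply: eq_bigr => j _; exact: (dpe 3 [:: (j : nat); (i : nat); m; N]).
have [cK hK] : recf 1 (den eK) by apply: recf_ex.
have [cA hA] : recf 1 (den eA) by apply: recf_ex.
have [cG hG] : recf 2 (den eG) by apply: recf_ex.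
exists (Comp D [:: cK; cA; Mu cG]).
  have dom p : halts (Comp D [:: cK; cA; Mu cG]) p ->
      exists K x, size x = L K /\ p = header K x.
    move=> [y /eval_comp_inv[ys]].
    move=> /evals_cons_inv[? [? [_ _ /evals_cons_inv[? [? [_ _]]]]]].
    move=> /evals_cons_inv[m [? [_ /eval_mu_inv[hm _] _]]] _.
    have := eval_fun hm (hG [:: m; str2nat p] erefl).
    set N := str2nat p; rewrite eGE /= => h.
    have : \sum_(K < N) \sum_(a < N) parse L N K a <> 0.
      by move=> h0; move: h; rewrite h0.
    move=> /eqP; rewrite sum_nat_eq0 => /forall_inPn[K _].
    rewrite sum_nat_eq0 => /forall_inPn[a _]; rewrite eqb0 negbK => /parse_header.
    by move=> [x [sx /str2nat_inj ->]]; exists K, x.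
  move=> p q /dom[K [x [sx ->]]] /dom[K' [x' [sx' ->]]] /header_prefix[eK' hpre].
  by subst K'; move: hpre; rewrite prefixE sx -sx' take_size => /eqP ->.
move=> K a z ha hz; have [p [sp hp]] := parse_exists ha.
exists p; split=> //; set N := str2nat p in hp *.
have /andP[ltK lta] := parse_lt hp.
have uniq i j : parse L N i j -> i = K /\ j = a by move=> h; apply: parse_inj h hp.
apply: ev_comp hz; constructor.
  by have := hK [:: N] erefl; rewrite eKE (sum_pick2 (fun i j => i) ltK lta hp uniq).
constructor.
  by have := hA [:: N] erefl; rewrite eAE (sum_pick2 (fun i j => j) ltK lta hp uniq).
constructor; last by constructor.
apply: ev_mu => //.
have := hG [:: 0; N] erefl; rewrite eGE.
suff -> : \sum_(i < N) \sum_(j < N) parse L N i j = 1 by [].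
rewrite -(sum_pick2 (fun i j => 1) ltK lta hp uniq).
by apply: eq_bigr => i _; apply: eq_bigr => j _; rewrite mul1n.
Qed.

(** * Compressible strings *)

Lemma uniq_all_eq (T : eqType) (x : T) s :
  uniq s -> (forall y, y \in s -> y = x) -> s = [::] \/ s = [:: x].
Proof.
case: s => [|y [|z s]] /= us h; first by left.
  by right; rewrite (h y (mem_head _ _)).
have ey := h y (mem_head _ _); have ez : z = x by apply: h; rewrite !inE eqxx orbT.
by move: us; rewrite ey ez inE eqxx.
Qed.

(** Kraft's inequality scaled by 2^L, by induction on [L]: the empty string, if present, is alone in
    [P]; otherwise removing the first bit splits [P] into two families for the previous bound. *)
Lemma kraft L (P : seq (seq bool)) :
  uniq P -> (forall p q, p \in P -> q \in P -> prefix p q -> p = q) ->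
  (forall p, p \in P -> size p <= L) ->
  \sum_(p <- P) 2 ^ (L - size p) <= 2 ^ L.
Proof.
elim: L P => [|L IH] P uP pf sP.
  have [|->|->] := @uniq_all_eq _ [::] P uP.
  - by move=> y /sP; rewrite leqn0 => /nilP.
  - by rewrite big_nil.
  - by rewrite big_seq1.
have [nilP|nilP] := boolP ([::] \in P).
  have [|->|->] := @uniq_all_eq _ [::] P uP.
  - by move=> y /(pf _ _ nilP) <- //; case: y.
  - by rewrite big_nil.
  - by rewrite big_seq1 subn0.
pose half b := [seq behead p | p <- P & head false p == b].
have hcons p : p \in P -> p = head false p :: behead p.
  by case: p => // h; rewrite h in nilP.
have inhalf b q : q \in half b -> (b :: q) \in P.
  move=> /mapP[p]; rewrite mem_filter => /andP[/eqP <- hp] ->.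
  by rewrite -hcons.
have bound b : \sum_(q <- half b) 2 ^ (L - size q) <= 2 ^ L.
  apply: IH.
  - rewrite map_inj_in_uniq ?filter_uniq // => p q.
    rewrite !mem_filter => /andP[/eqP hp inp] /andP[/eqP hq inq] e.
    by rewrite (hcons _ inp) (hcons _ inq) hp hq e.
  - move=> p q /inhalf hp /inhalf hq pq.
    suff [] : b :: p = b :: q by [].
    by apply: pf => //=; rewrite eqxx.
  - by move=> p /inhalf /sP.
have split b : \sum_(q <- half b) 2 ^ (L - size q) =
    \sum_(p <- P | head false p == b) 2 ^ (L.+1 - size p).
  rewrite big_map big_filter big_seq_cond [RHS]big_seq_cond.
  by apply: eq_bigr => p /andP[/hcons -> _].
rewrite (bigID (fun p => head false p == true)) /= -split.
rewrite [X in _ + X](eq_bigl (fun p => head false p == false)); last first.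
  by move=> p; case: (head _ _).
by rewrite -split expnS mul2n -addnn leq_add.
Qed.

(** The strings with H_V(s) < |s|, where [s] and [p] are the numbers of a string and of a program
    for it. *)
Definition short V s :=
  exists2 p, eval V [:: p] s & codelen p < codelen s.

(** For [s < k] this is membership in W_k. *)
Definition found (F : seq nat -> nat) k s : bool :=
  [exists p : 'I_k, exists t : 'I_k,
    (F [:: t : nat; p : nat] == s.+1) && (codelen p < codelen s)].

Lemma found_short V F k s : approximates 1 V F -> found F k s -> short V s.
Proof.
move=> [_ sF _] /existsP[p /existsP[t /andP[/eqP hF hl]]].
by exists p => //; apply: sF hF.
Qed.

(** The fuel is existentially quantified below [k], so monotonicity in [k] asks nothing of [F]. *)
Lemma found_mono F k k' s : k <= k' -> found F k s -> found F k' s.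
Proof.
move=> hk /existsP[p /existsP[t h]].
by apply/existsP; exists (widen_ord hk p); apply/existsP; exists (widen_ord hk t).
Qed.

Lemma short_found V F s : approximates 1 V F -> short V s ->
  exists k, forall k', k <= k' -> (s < k') && found F k' s.
Proof.
move=> [_ _ cF] [p hp hl]; have [//|t ht] := cF [:: p] s _ hp.
exists (maxn s.+1 (maxn p.+1 t.+1)) => k'.
rewrite !geq_max => /and3P[hs hpk htk]; rewrite hs /=.
apply/existsP; exists (Ordinal hpk); apply/existsP; exists (Ordinal htk) => /=.
by rewrite ht // eqxx.
Qed.

Lemma recf_found F : recf 2 F -> recf 2 (fun l => found F (nth 0 l 0) (nth 0 l 1)).
Proof.
move=> hF.
have : wfe 2 (Leq (Cst 1) (Sum (Var 0) (Sum (Var 1)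
   (Mul (Eqn (Fn2 (fun t p => F [:: t; p]) (Var 0) (Var 1)) (Add (Var 3) (Cst 1)))
   (Leq (Add (Fn1 codelen (Var 1)) (Cst 1)) (Fn1 codelen (Var 3))))))).
  rewrite /=; repeat match goal with |- _ /\ _ => split end => //; try exact: recf_codelen.
  by apply: (recf_ext _ hF) => -[|? [|? []]].
move=> /recf_ex; apply: recf_ext => -[//|k [//|s l]] _ /=; congr nat_of_bool.
rewrite lt0n sum_nat_eq0 negb_forall; apply: eq_existsb => p /=.
rewrite sum_nat_eq0 negb_forall; apply: eq_existsb => t /=.
by rewrite mulnb eqb0 negbK !addn1.
Qed.

(** This is 2^k S_k; the subtraction does not truncate, as [codelen s <= s < k]. *)
Definition mass F k := \sum_(s < k) found F k s * 2 ^ (k - codelen s).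

(** Choose for each found string a program shorter than it. Distinct strings get distinct programs,
    and Kraft's inequality applies to these. *)
Lemma mass_le V F k : prefix_free V -> approximates 1 V F -> mass F k <= 2 ^ k.
Proof.
move=> pfV aF.
have /choice[f fP] s : exists p, found F k s -> eval V [:: str2nat p] s /\ size p < codelen s.
  have [|h] := boolP (found F k s); last by exists [::].
  move=> /(found_short aF)[p hp lp]; have [q hq] := str2nat_surj p.
  by exists q => _; rewrite -hq codelen_str2nat in hp lp *.
pose P := [seq f s | s <- [seq s <- iota 0 k | found F k s]].
have inP p : p \in P -> exists2 s, (p = f s) & [/\ eval V [:: str2nat p] s,
    size p < codelen s & codelen s <= k].
  move=> /mapP[s]; rewrite mem_filter mem_iota add0n => /andP[/fP[h1 h2] hs] ->.
  by exists s => //; split=> //; apply: leq_trans (codelen_le s) (ltnW hs).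
apply: leq_trans (@kraft k P _ _ _).
- rewrite big_map big_filter /mass.
  rewrite -(big_mkord xpredT (fun s => found F k s * 2 ^ (k - codelen s))).
  rewrite [X in _ <= X]big_mkcond.
  rewrite /index_iota subn0; apply: leq_sum => s _.
  have [/fP[_ h]|_] := boolP (found F k s); last by [].
  by rewrite mul1n leq_exp2l // leq_sub2l // ltnW.
- rewrite map_inj_in_uniq ?filter_uniq ?iota_uniq // => s t.
  rewrite !mem_filter => /andP[/fP[h1 _] _] /andP[/fP[h2 _] _] e.
  by rewrite e in h1; apply: eval_fun h1 h2.
- move=> p q /inP[s _ [hs _ _]] /inP[t _ [ht _ _]].
  by apply: pfV; [exists s|exists t].
- by move=> p /inP[s _ [_ h1 h2]]; apply: leq_trans (ltnW h1) h2.
Qed.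

(** A machine that sends 1^K 0 to the string numbered 2^(2K) halves lengths up to a constant, which
    beats the overhead of [V] for large K. *)
Lemma optimal_short V : optimal V -> exists s, short V s.
Proof.
move=> [_ optV].
have [c hc] : recf 3 (den (Exp (Cst 2) (Mul (Cst 2) (Var 0)))) by apply: recf_ex.
have [C pfC hC] := @header_machine (fun=> 0) c (recf_const 1 0).
have [d hd] := optV _ pfC.
(* For K = d + 2 the input has length d + 3, so [V] needs at most 2d + 3 bits for a string of length
   2d + 4. *)
have [p [sp hp]] := hC d.+2 0 _ (ltn0Sn 0) (hc [:: d.+2; 0; 0] erefl).
pose n := 2 ^ (2 * d.+2); have {}hp : eval C [:: str2nat p] n := hp.
have [s hs] := str2nat_surj n; rewrite -hs in hp.
have [q [hq sq]] := hd _ _ hp.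
exists n; exists (str2nat q); first by rewrite -hs.
rewrite codelen_str2nat; apply: leq_ltn_trans sq _; rewrite sp.
have /andP[_ h] := codelen_bounds n.
have : 2 * d.+2 < (codelen n).+1.
  by rewrite -(@ltn_exp2l 2) //; apply: leq_ltn_trans h; rewrite -/n.
by lia.
Qed.

(** * The decoding machine *)

Lemma total_recursive_recf g : total_recursive g -> recf 1 (fun l => g (nth 0 l 0)).
Proof. by move=> [c hc]; exists c => -[|n []]. Qed.

Definition least (P : pred nat) n := P n /\ forall m, m < n -> ~~ P m.

Lemma least_exists (P : pred nat) n : P n -> exists m, least P m.
Proof.
move=> hn; have hex : exists n, P n by exists n.
case: (ex_minnP hex) => m hm hmin; exists m; split=> // k.
by apply: contraL => /hmin; rewrite leqNgt.
Qed.

Lemma eval_mu_least c (P : pred nat) l n :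
  (forall m, eval c (m :: l) (~~ P m)) -> least P n -> eval (Mu c) l n.
Proof.
move=> hc [hn hlt]; apply: ev_mu; first by have := hc n; rewrite hn.
by move=> m /hlt hm; exists 0; have := hc m; rewrite hm.
Qed.

(** Two unbounded searches in sequence: first the stage [k] from [K] and [e], then the index [j]
    from [k] and [K]. The argument 0 is the one supplied by [header_machine]. *)
Lemma nested_search (P : nat -> nat -> nat -> bool) (Q : nat -> nat -> nat -> bool)
    (out : nat -> nat -> nat) :
  recf 3 (fun l => P (nth 0 l 1) (nth 0 l 2) (nth 0 l 0)) ->
  recf 3 (fun l => Q (nth 0 l 1) (nth 0 l 2) (nth 0 l 0)) ->
  recf 2 (fun l => out (nth 0 l 0) (nth 0 l 1)) ->
  exists D, forall K e k j, least (P K e) k -> least (Q k K) j ->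
    eval D [:: K; e; 0] (out j K).
Proof.
move=> hP hQ [co ho].
have [cP hcP] : recf 4 (fun l => ~~ P (nth 0 l 1) (nth 0 l 2) (nth 0 l 0)).
  have := recf_leq (recf_comp hP (recfs_cons (recf_nth 4 0) (recfs_cons (recf_nth 4 1)
    (recfs_cons (recf_nth 4 2) (recfs_nil 4))))) (recf_const 4 0).
  by apply: recf_ext => l _; rewrite leqn0 eqb0.
have [cQ hcQ] : recf 3 (fun l => ~~ Q (nth 0 l 1) (nth 0 l 2) (nth 0 l 0)).
  by have := recf_leq hQ (recf_const 3 0); apply: recf_ext => l _; rewrite leqn0 eqb0.
exists (Comp (Comp co [:: Mu cQ; Proj 1]) [:: Mu cP; Proj 0]) => K e k j hk hj.
apply: (@ev_comp _ _ _ [:: k; K]).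
  constructor; last by constructor; [exact: (ev_proj 0 [:: K; e; 0])|constructor].
  by apply: eval_mu_least hk => m; apply: (hcP [:: m; K; e; 0]).
apply: (@ev_comp _ _ _ [:: j; K]); last exact: (ho [:: j; K]).
constructor; last by constructor; [exact: (ev_proj 1 [:: k; K])|constructor].
by apply: eval_mu_least hj => m; apply: (hcQ [:: m; k; K]).
Qed.

(* [root l u v M] is the integer part of 2^M 2^(-l v/u). *)
Definition root l u v M := \sum_(y < 2 ^ M) (y.+1 ^ u * 2 ^ (l * v) <= 2 ^ (M * u)).

Lemma recf_root :
  recf 4 (fun l => root (nth 0 l 0) (nth 0 l 1) (nth 0 l 2) (nth 0 l 3)).
Proof.
have : wfe 4 (Sum (Exp (Cst 2) (Var 3)) (Leq (Mul (Exp (Add (Var 0) (Cst 1)) (Var 2))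
  (Exp (Cst 2) (Mul (Var 1) (Var 3)))) (Exp (Cst 2) (Mul (Var 4) (Var 2))))) by [].
move=> /recf_ex; apply: recf_ext => -[|? [|? [|? [|? []]]]] //= _.
by apply: eq_bigr => i _; rewrite addn1.
Qed.

(** Theta_k(t_j) scaled by 2^(nu+k), each term rounded down; the [k] extra bits keep the total
    rounding error within 2^-nu. *)
Definition approx_sum F j k nu (u v : nat -> nat) :=
  \sum_(s < k) found F k s * root (codelen s) (u j) (v j).+1 (nu + k).

Lemma recf_approx_sum F u v : recf 2 F ->
  recf 1 (fun l => u (nth 0 l 0)) -> recf 1 (fun l => v (nth 0 l 0)) ->
  recf 3 (fun l => approx_sum F (nth 0 l 0) (nth 0 l 1) (nth 0 l 2) u v).
Proof.
move=> hF hu hv; have rF := recf_found hF.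
have h : recf 4 (fun l => root (codelen (nth 0 l 0)) (u (nth 0 l 1)) (v (nth 0 l 1)).+1
    (nth 0 l 3 + nth 0 l 2)).
  apply: (@recf_comp 4 4 _ (fun l => [:: codelen (nth 0 l 0); u (nth 0 l 1);
    (v (nth 0 l 1)).+1; nth 0 l 3 + nth 0 l 2]) recf_root).
  apply: recfs_cons; first exact: (@recf_ex 4 (Fn1 codelen (Var 0)) (conj recf_codelen I)).
  apply: recfs_cons; first exact: (@recf_ex 4 (Fn1 u (Var 1)) (conj hu I)).
  apply: recfs_cons.
    by apply: recf_succ; exact: (@recf_ex 4 (Fn1 v (Var 1)) (conj hv I)).
  apply: recfs_cons (recfs_nil 4).
  by apply: recf_add; exact: recf_nth.
have : wfe 3 (Sum (Var 1) (Mul (Fn2 (found F) (Var 2) (Var 0)) (Opq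
  (fun l => root (codelen (nth 0 l 0)) (u (nth 0 l 1)) (v (nth 0 l 1)).+1
    (nth 0 l 3 + nth 0 l 2))))) by [].
by move=> /recf_ex; apply: recf_ext.
Qed.

Lemma recf_mass F : recf 2 F -> recf 1 (fun l => mass F (nth 0 l 0)).
Proof.
move=> hF; have rF := recf_found hF; have rc := recf_codelen.
have : wfe 1 (Sum (Var 0) (Mul (Fn2 (found F) (Var 1) (Var 0))
  (Exp (Cst 2) (Sub (Var 1) (Fn1 codelen (Var 0)))))) by [].
by move=> /recf_ex; apply: recf_ext.
Qed.

(* The string of the first [n] binary digits of v / 2^n, as a number. *)
Definition digits n v := \sum_(i < n) 2 ^ i * (1 + odd (v %/ 2 ^ (n - i.+1))).

Lemma recf_digits : recf 2 (fun l => digits (nth 0 l 0) (nth 0 l 1)).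
Proof.
pose q := Div (Var 2) (Sub (Exp (Cst 2) (Sub (Var 1) (Add (Var 0) (Cst 1)))) (Cst 1)).
have : wfe 2 (Sum (Var 0) (Mul (Exp (Cst 2) (Var 0)) (Add (Cst 1)
  (Sub q (Mul (Div q (Cst 1)) (Cst 2)))))) by [].
move=> /recf_ex; apply: recf_ext => -[|n [|v []]] //= _; apply: eq_bigr => i _.
rewrite subn1 addn1 prednK ?expn_gt0 // -modn2; congr (_ * (1 + _)).
by rewrite [X in X - _](divn_eq _ 2) addKn.
Qed.

Lemma digits_str2nat n v (b : nat -> bool) :
  (forall i, i < n -> b i.+1 = odd (v %/ 2 ^ (n - i.+1))) ->
  str2nat [seq b i | i <- iota 1 n] = digits n v.
Proof.
rewrite /digits => h.
rewrite (eq_bigr (fun i : 'I_n => 2 ^ i * (1 + b i.+1))); last by move=> i _; rewrite h.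
elim: n b {v h} => [|n IH] b; first by rewrite big_ord0.
rewrite [iota _ _]/= map_cons str2nat_cons -[in iota 2 n](addn1 1) iotaDl -map_comp.
rewrite (IH (b \o addn 1)) big_ord_recl mul1n /= big_distrr /=.
rewrite -addnA [in LHS]addnC; congr (_ + _).
by apply: eq_bigr => i _; rewrite /bump /= mulnA -expnS.
Qed.

Definition mass_reaches F B K e k := e * 2 ^ k <= mass F k * 2 ^ (B * K).

(** The rounded Theta_k(t_j) is at most w_j + 2^-(B K), multiplied out to natural numbers, with w_j
    = (b j - a j)/(c j + 1). The parameter [B] is later instantiated by B'. *)
Definition sum_below F (u v a b c : nat -> nat) B k K j :=
  approx_sum F j k (B * K) u v * (c j).+1 + 2 ^ (B * K + k) * a j <=
    2 ^ (B * K + k) * b j + 2 ^ k * (c j).+1.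

(** The constants [r] and [y], the remainder of n modulo B' and the correction to t_j, select one of
    finitely many machines. *)
Definition output (u v : nat -> nat) B r y j K :=
  digits (B * K + r) ((2 ^ (B * K + r) * u j) %/ (v j).+1 - y).

Lemma decoder F (u v a b c : nat -> nat) B B' r y :
  recf 2 F ->
  recf 1 (fun l => u (nth 0 l 0)) -> recf 1 (fun l => v (nth 0 l 0)) ->
  recf 1 (fun l => a (nth 0 l 0)) -> recf 1 (fun l => b (nth 0 l 0)) ->
  recf 1 (fun l => c (nth 0 l 0)) ->
  exists D, forall K e k j, least (mass_reaches F B K e) k ->
    least (sum_below F u v a b c B' k K) j ->
    eval D [:: K; e; 0] (output u v B' r y j K).
Proof.
move=> hF hu hv ha hb hc; apply: nested_search.
- have rm := recf_mass hF.
  have : wfe 3 (Leq (Mul (Var 2) (Exp (Cst 2) (Var 0)))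
    (Mul (Fn1 (mass F) (Var 0)) (Exp (Cst 2) (Mul (Cst B) (Var 1))))) by [].
  by move=> /recf_ex; apply: recf_ext.
- have ra : recf 3 (fun l => approx_sum F (nth 0 l 0) (nth 0 l 1) (B' * nth 0 l 2) u v).
    apply: (@recf_comp 3 3 _ (fun l => [:: nth 0 l 0; nth 0 l 1; B' * nth 0 l 2])
      (recf_approx_sum hF hu hv)).
    do 2!(apply: recfs_cons; first exact: recf_nth).
    apply: recfs_cons (recfs_nil 3).
    exact: (@recf_ex 3 (Mul (Cst B') (Var 2))).
  pose p := Exp (Cst 2) (Add (Mul (Cst B') (Var 2)) (Var 1)).
  have : wfe 3 (Leq (Add (Mul
      (Opq (fun l => approx_sum F (nth 0 l 0) (nth 0 l 1) (B' * nth 0 l 2) u v))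
      (Add (Fn1 c (Var 0)) (Cst 1))) (Mul p (Fn1 a (Var 0))))
    (Add (Mul p (Fn1 b (Var 0))) (Mul (Exp (Cst 2) (Var 1)) (Add (Fn1 c (Var 0)) (Cst 1))))).
    by [].
  by move=> /recf_ex; apply: recf_ext => l _ /=; rewrite /sum_below addn1.
- pose n := Add (Mul (Cst B') (Var 1)) (Cst r).
  have rd := recf_digits.
  have : wfe 2 (Fn2 digits n (Sub (Div (Mul (Exp (Cst 2) n) (Fn1 u (Var 0)))
    (Fn1 v (Var 0))) (Cst y))) by [].
  by move=> /recf_ex; apply: recf_ext.
Qed.

(** * Estimates on partial sums of Theta *)

Local Open Scope ring_scope.
Local Open Scope classical_set_scope.

Lemma short_compressible {R : realType} V s :
  (Hc (R := R) V s < ((size s)%:R)%:E)%E <-> short V (str2nat s).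
Proof.
split=> [/ereal_inf_lt[_ [p hp <-]]|[p hp hl]].
  rewrite lte_fin ltr_nat => hl; exists (str2nat p) => //.
  by rewrite !codelen_str2nat.
have [q hq] := str2nat_surj p; rewrite -hq !codelen_str2nat in hp hl.
apply: (@le_lt_trans _ _ ((size q)%:R)%:E); last by rewrite lte_fin ltr_nat.
by apply: ereal_inf_lbound; exists q.
Qed.

Definition weight {R : realType} (l : nat) (x : R) : R := 2 `^ (- l%:R / x).

Definition partial_theta {R : realType} F k (x : R) : R :=
  \sum_(s < k) (found F k s)%:R * weight (codelen s) x.

Lemma weight_ge0 {R : realType} l (x : R) : 0 <= weight l x.
Proof. exact: powR_ge0. Qed.

Lemma weight_gt0 {R : realType} l (x : R) : 0 < weight l x.
Proof. by rewrite powR_gt0. Qed.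

Lemma sum_subseq_le {R : numDomainType} (T : eqType) (f : T -> R) (r s : seq T) :
  (forall x, 0 <= f x) -> uniq r -> uniq s -> {subset r <= s} ->
  \sum_(x <- r) f x <= \sum_(x <- s) f x.
Proof.
move=> f0 ur us rs.
have : perm_eq r [seq x <- s | x \in r].
  apply: uniq_perm => //; first exact: filter_uniq.
  by move=> x; rewrite mem_filter andb_idr // => /rs.
move=> /(perm_big _) ->; rewrite big_filter big_mkcond.
by apply: ler_sum => x _; case: ifP.
Qed.

Lemma partial_thetaE {R : realType} F k (x : R) :
  partial_theta F k x =
    \sum_(s <- [seq s <- iota 0 k | found F k s]) weight (codelen s) x.
Proof.
rewrite big_filter /partial_theta [RHS]big_mkcond.
rewrite -[X in iota 0 X]subn0.
rewrite -(big_mkord xpredT (fun s => (found F k s)%:R * weight (codelen s) x)).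
by apply: eq_bigr => s _; case: (found _ _ _); rewrite ?mul1r ?mul0r.
Qed.

Lemma partial_theta_le {R : realType} V F k (T theta : R) :
  approximates 1 V F -> Theta V T = theta%:E -> partial_theta F k T <= theta.
Proof.
move=> aF hT; rewrite -lee_fin -hT partial_thetaE.
have [g gK] : exists g, cancel g str2nat.
  by have /choice[g hg] := str2nat_surj; exists g.
pose r := [seq g s | s <- [seq s <- iota 0 k | found F k s]].
apply: esum_ge; exists [set` r].
  split; first exact: finite_seq.
  move=> s /= /mapP[n]; rewrite mem_filter => /andP[hn _] ->.
  by apply/short_compressible; rewrite gK; apply: found_short hn.
rewrite -fsbig_seq; last first.
  by rewrite (map_inj_uniq (can_inj gK)) filter_uniq ?iota_uniq.
rewrite big_map -sumEFin lee_sum // => s _.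
by rewrite /weight -{1}(gK s) codelen_str2nat.
Qed.

(** Theta is the supremum of its finite subsums, and finitely many compressible strings all lie in
    W_k for one large [k]. *)
Lemma theta_le {R : realType} V F (T theta x : R) :
  approximates 1 V F -> Theta V T = theta%:E ->
  (forall k, partial_theta F k T <= x) -> theta <= x.
Proof.
move=> aF hT hx; rewrite -lee_fin -hT.
apply: ge_ereal_sup => _ [A [/finite_seqP[r' ->] hA] <-].
set r := undup r'.
have -> : [set` r'] = [set` r] by apply/seteqP; split=> y /=; rewrite mem_undup.
rewrite -fsbig_seq ?undup_uniq // sumEFin lee_fin.
have [k hk] : exists k, forall s, s \in r -> (str2nat s < k)%N && found F k (str2nat s).
  have : forall s, s \in r -> short V (str2nat s).
    by move=> s; rewrite mem_undup => /hA /short_compressible.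
  elim: r => [|s r IH] hs; first by exists 0%N.
  case: IH => [t ht|k hk]; first by apply: hs; rewrite inE ht orbT.
  have [k' hk'] := short_found aF (hs s (mem_head _ _)).
  exists (maxn k k') => t; rewrite inE => /orP[/eqP->|/hk /andP[h1 h2]].
    by apply: hk'; rewrite leq_maxr.
  rewrite (leq_trans h1) ?leq_maxl //=.
  by apply: found_mono h2; rewrite leq_maxl.
apply: le_trans (hx k); rewrite partial_thetaE.
rewrite (eq_bigr (fun s => weight (codelen (str2nat s)) T)); last first.
  by move=> s _; rewrite codelen_str2nat.
rewrite -(big_map str2nat xpredT (fun s => weight (codelen s) T)).
apply: sum_subseq_le.
- by move=> s; apply: weight_ge0.
- by rewrite (map_inj_uniq str2nat_inj) undup_uniq.
- by rewrite filter_uniq ?iota_uniq.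
- move=> _ /mapP[s hs ->]; rewrite mem_filter mem_iota add0n /=.
  by have /andP[-> ->] := hk _ hs.
Qed.

Lemma weightE {R : realType} l (x : R) : weight l x = expR (- (l%:R / x) * ln 2).
Proof. by rewrite /weight /powR pnatr_eq0 mulNr. Qed.

(** At a rational argument, comparing a weight with a dyadic number becomes an integer comparison
    after raising to the power [u]. *)
Lemma weight_frac {R : realType} l (u v : nat) : (0 < u)%N ->
  weight l (u%:R / v%:R : R) ^+ u = (2 ^+ (l * v))^-1.
Proof.
move=> u0; rewrite /weight -powR_mulrn ?powR_ge0 // -powRrM.
rewrite invf_div mulrA divfK ?pnatr_eq0 -?lt0n //.
by rewrite mulNr powRN -natrM powR_mulrn.
Qed.

Lemma weight_mono {R : realType} l (x y : R) : 0 < x -> x <= y -> weight l x <= weight l y.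
Proof.
move=> x0 xy; rewrite ler_powR // ?ler1n //.
rewrite !mulNr lerN2 ler_wpM2l //.
by rewrite lef_pV2 // posrE // (lt_le_trans x0).
Qed.

Lemma weight_le1 {R : realType} l (x : R) : 0 < x -> weight l x <= 1.
Proof.
move=> x0; rewrite -[leRHS](powRr0 2) ler_powR ?ler1n //.
by rewrite mulNr oppr_le0 divr_ge0 // ltW.
Qed.

Lemma rootE {R : realType} l u v M : (0 < u)%N ->
  root l u v M = Num.truncn (2 ^+ M * weight l (u%:R / v%:R : R)).
Proof.
move=> u0; set x : R := u%:R / v%:R; set rho := 2 ^+ M * weight l x.
have rho0 : 0 <= rho by rewrite mulr_ge0 ?exprn_ge0 ?weight_ge0.
have w1 : weight l x <= 1.
  (* For [v = 0] the inverse of 0 is 0 by convention, and the weight is 2^0 = 1. *)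
  rewrite /x /weight; case: v {x rho rho0} => [|v].
    by rewrite invr0 mulr0 invr0 mulr0 powRr0.
  by apply: weight_le1; rewrite divr_gt0 // ltr0n.
apply: (@sum_threshold (fun y => (y.+1 ^ u * 2 ^ (l * v) <= 2 ^ (M * u))%N)) => [|y _].
  rewrite -(ler_nat R) natrX; apply: (@le_trans _ _ rho); first by rewrite truncn_le.
  by rewrite ler_piMr // exprn_ge0.
rewrite truncn_gt_nat -(ler_pXn2r u0) ?nnegrE //.
rewrite exprMn weight_frac // ler_pdivlMr ?exprn_gt0 // -exprM.
by rewrite -!natrX -natrM ler_nat.
Qed.

Lemma approx_sum_bounds {R : realType} F j k nu u v (x := (u j)%:R / (v j).+1%:R : R) :
  (0 < u j)%N ->
  (approx_sum F j k nu u v)%:R / 2 ^+ (nu + k) <= partial_theta F k x <=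
  (approx_sum F j k nu u v)%:R / 2 ^+ (nu + k) + 2 ^- nu.
Proof.
move=> u0; have P0 : (0 : R) < 2 ^+ (nu + k) by rewrite exprn_gt0.
rewrite ler_pdivrMr // [X in _ + X](_ : _ = 2 ^+ k / 2 ^+ (nu + k)); last first.
  by rewrite exprD invfM mulrCA divff ?mulr1 // expf_neq0.
rewrite -mulrDl ler_pdivlMr // /approx_sum /partial_theta natr_sum mulr_suml.
have hk : (k%:R : R) <= 2 ^+ k by rewrite -natrX ler_nat ltnW // ltn_expl.
have rb s : (root (codelen s) (u j) (v j).+1 (nu + k))%:R <=
    weight (codelen s) x * 2 ^+ (nu + k) <
    (root (codelen s) (u j) (v j).+1 (nu + k)).+1%:R.
  rewrite (rootE (R := R)) // -/x [_ * 2 ^+ _]mulrC; apply: truncn_itv.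
  by rewrite mulr_ge0 ?exprn_ge0 ?weight_ge0.
apply/andP; split.
  apply: ler_sum => s _; rewrite natrM -mulrA ler_wpM2l //.
  by have /andP[] := rb s.
apply: (@le_trans _ _ (\sum_(s < k)
  ((found F k s * root (codelen s) (u j) (v j).+1 (nu + k))%:R + 1))).
  apply: ler_sum => s _; rewrite natrM -mulrA; have /andP[_ /ltW] := rb s.
  by case: (found _ _ _) => h; rewrite ?mul1r ?mul0r ?add0r ?ler01 ?natr1.
by rewrite big_split /= sumr_const card_ord lerD2l.
Qed.

Lemma sum_belowP {R : realType} F (u v a b c : nat -> nat) B k K j :
  (sum_below F u v a b c B k K j) =
  ((approx_sum F j k (B * K) u v)%:R / 2 ^+ (B * K + k) <=
    ((b j)%:R - (a j)%:R) / (c j).+1%:R + 2 ^- (B * K) :> R).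
Proof.
rewrite /sum_below -(ler_nat R) !natrD !natrM !natrX.
set A := (approx_sum _ _ _ _ _ _)%:R; rewrite exprD.
have p1 : (0 : R) < 2 ^+ (B * K) by rewrite exprn_gt0.
have p2 : (0 : R) < 2 ^+ k by rewrite exprn_gt0.
have p3 : (0 : R) < (c j).+1%:R by rewrite ltr0n.
set P := 2 ^+ (B * K) in p1 *; set Q := 2 ^+ k in p2 *; set C := _.+1%:R in p3 *.
rewrite ler_pdivrMr ?mulr_gt0 // -[RHS](ler_pM2r p3).
rewrite [X in _ = (_ <= X)](_ : _ = P * Q * (b j)%:R + Q * C - P * Q * (a j)%:R); last first.
  by field; rewrite !gt_eqF.
by rewrite lerBrDr.
Qed.

Lemma partial_theta_cvg {R : realType} F k (t : nat -> R) (T : R) : 0 < T ->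
  t n @[n --> \oo] --> T -> partial_theta F k (t n) @[n --> \oo] --> partial_theta F k T.
Proof.
move=> T0 ht; rewrite /partial_theta.
apply: cvg_big => [|s _]; first exact: add_continuous.
apply: cvgMr; under eq_fun do rewrite weightE; rewrite weightE.
apply: (@continuous_cvg _ _ _ _ _ _ (@expR R)); first exact: continuous_expR.
apply: cvgMl; apply: cvgN; apply: cvgMr.
by apply: cvgV => //; rewrite gt_eqF.
Qed.

(** * The mass S_k and the strings that it misses *)

Lemma weight1 {R : realType} l : weight l 1 = 2 ^- l :> R.
Proof. by rewrite /weight divr1 powRN powR_mulrn. Qed.

(** Since S_k is Theta_k(1), the facts about [partial_theta] serve for both sums. *)
Lemma mass_partial_theta {R : realType} F k :
  (mass F k)%:R = partial_theta F k 1 * 2 ^+ k :> R.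
Proof.
rewrite /mass /partial_theta natr_sum mulr_suml; apply: eq_bigr => s _.
rewrite natrM -mulrA weight1 natrX; congr (_ * _).
have hs : (codelen s <= k)%N by apply: leq_trans (codelen_le s) (ltnW _).
by rewrite -[X in _ * _ ^+ X](subnKC hs) exprD mulKf // expf_neq0.
Qed.

(** The strings of W_k' outside W_k; the test [s < k] is explicit because [found F k] may also hold
    at larger numbers. *)
Definition fresh F k k' s := found F k' s && ~~ ((s < k)%N && found F k s).

Lemma partial_theta_fresh {R : realType} F k k' (x : R) : (k <= k')%N ->
  partial_theta F k' x - partial_theta F k x =
    \sum_(s < k') (fresh F k k' s)%:R * weight (codelen s) x.
Proof.
move=> kk; rewrite /partial_theta.
rewrite (big_ord_widen k' (fun s => (found F k s)%:R * weight (codelen s) x)) //.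
rewrite [X in _ - X]big_mkcond -sumrB; apply: eq_bigr => s _; rewrite /fresh.
case: ifP => _ /=; last by rewrite subr0 andbT.
case: (boolP (found F k s)) => [/(found_mono kk) ->|_]; first by rewrite subrr mul0r.
by rewrite mul0r subr0 andbT.
Qed.

Lemma fresh_weight {R : realType} F k k' (d : R) s : (k <= k')%N ->
  partial_theta F k' 1 - partial_theta F k 1 < d ->
  (s < k')%N -> fresh F k k' s -> 2 ^- codelen s < d.
Proof.
move=> kk + hs hf; apply: le_lt_trans; rewrite partial_theta_fresh //.
rewrite (bigD1 (Ordinal hs)) //= hf mul1r weight1 lerDl.
by apply: sumr_ge0 => i _; rewrite mulr_ge0 ?weight_ge0.
Qed.

Lemma fresh_codelen {R : realType} F k k' m s : (k <= k')%N ->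
  partial_theta F k' 1 - partial_theta F k 1 < 2 ^- m :> R ->
  (s < k')%N -> fresh F k k' s -> (m < codelen s)%N.
Proof.
move=> kk hd hs /(fresh_weight kk hd hs).
by rewrite ltf_pV2 ?posrE ?exprn_gt0 // ltr_eXn2l // ltr1n.
Qed.

(* Every fresh string has length at least m, so that 2^(-l/T) is at most
   2^(-l) 2^(-m(1/T-1)). *)
Lemma partial_theta_tail {R : realType} F k k' m (T : R) : 0 < T -> T < 1 ->
  (k <= k')%N -> partial_theta F k' 1 - partial_theta F k 1 < 2 ^- m :> R ->
  partial_theta F k' T <= partial_theta F k T + weight m T.
Proof.
move=> T0 T1 kk hd; rewrite -lerBlDl partial_theta_fresh //.
have split l : weight l T = weight l (1 : R) * 2 `^ (- (l%:R * (T^-1 - 1))).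
  rewrite /weight -powRD; last by rewrite pnatr_eq0 implybT.
  by congr (_ `^ _); rewrite divr1; ring.
have iT : 0 <= T^-1 - 1 by rewrite subr_ge0 invf_ge1 // ltW.
rewrite split; apply: (@le_trans _ _
  ((partial_theta F k' (1 : R) - partial_theta F k 1) * 2 `^ (- (m%:R * (T^-1 - 1))))).
  rewrite partial_theta_fresh // mulr_suml; apply: ler_sum => s _.
  case: (boolP (fresh F k k' s)) => [hs|_]; last by rewrite !mul0r.
  rewrite !mul1r split ler_wpM2l ?weight_ge0 // ler_powR ?ler1n //.
  rewrite lerN2 ler_wpM2r // ler_nat ltnW //.
  exact: (fresh_codelen kk hd (ltn_ord s) hs).
by rewrite ler_wpM2r ?powR_ge0 // weight1 ltW.
Qed.

(** * Growth of the partial sums in their argument *)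

Lemma weight_slope {R : realType} l (x y : R) :
  weight l x * (1 + l%:R * ln 2 * (x^-1 - y^-1)) <= weight l y.
Proof.
have -> : weight l y = weight l x * expR (l%:R * ln 2 * (x^-1 - y^-1)).
  by rewrite !weightE -expRD; congr expR; ring.
by rewrite ler_wpM2l ?weight_ge0 // expR_ge1Dx.
Qed.

(** Every weight increases with its argument, so the growth of the single term [s] is a lower bound
    for that of the sum. *)
Lemma partial_theta_slope {R : realType} F k s (x y : R) : 0 < x -> x <= y ->
  (s < k)%N -> found F k s ->
  weight (codelen s) x * ((codelen s)%:R * ln 2) * (x^-1 - y^-1) <=
    partial_theta F k y - partial_theta F k x.
Proof.
move=> x0 xy hs hf; rewrite /partial_theta -sumrB (bigD1 (Ordinal hs)) //= hf !mul1r.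
rewrite -[leLHS]addr0 lerD //.
  by have := weight_slope (codelen s) x y; rewrite mulrDr mulr1 mulrA -lerBrDl.
by apply: sumr_ge0 => i _; rewrite -mulrBr mulr_ge0 // subr_ge0 weight_mono.
Qed.

(** * The number that determines the stage *)

Lemma mass_reachesE {R : realType} F B K e k :
  mass_reaches F B K e k = (e%:R / 2 ^+ (B * K) <= partial_theta F k 1 :> R).
Proof.
rewrite /mass_reaches -(ler_nat R) !natrM !natrX mass_partial_theta.
rewrite ler_pdivrMr ?exprn_gt0 // -[RHS](@ler_pM2r _ (2 ^+ k)) ?exprn_gt0 //.
by rewrite mulrAC.
Qed.

(** Take the largest [e] reached at some stage. Kraft's inequality gives [e <= 2 ^ (B * K)], and as
    equality is not excluded one bit is added. *)
Lemma mass_stage V F B K : prefix_free V -> approximates 1 V F ->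
  exists e, [/\ (e < 2 ^ (B * K + 1))%N, exists k, mass_reaches F B K e k &
    forall k, ~~ mass_reaches F B K e.+1 k].
Proof.
move=> pfV aF; pose P e := `[< exists k, mass_reaches F B K e k >].
have P0 : exists e, P e by exists 0%N; apply/asboolP; exists 0%N; rewrite /mass_reaches.
have Pub e : P e -> (e <= 2 ^ (B * K))%N.
  move=> /asboolP[k]; rewrite /mass_reaches => h.
  rewrite -(@leq_pmul2r (2 ^ k)) ?expn_gt0 // (leq_trans h) // mulnC leq_mul2l.
  by rewrite (mass_le _ pfV aF) orbT.
case: (ex_maxnP P0 Pub) => e /asboolP he hmax; exists e; split=> //.
  case: he => k hk; apply: (@leq_ltn_trans (2 ^ (B * K))%N).
    by apply: Pub; apply/asboolP; exists k.
  by rewrite ltn_exp2l // addn1.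
move=> k; apply/negP => hk; have : P e.+1 by apply/asboolP; exists k.
by move=> /hmax; rewrite ltnn.
Qed.

Lemma stage_gap {R : realType} F B K e k k' :
  mass_reaches F B K e k -> ~~ mass_reaches F B K e.+1 k' ->
  partial_theta F k' 1 - partial_theta F k 1 < 2 ^- (B * K) :> R.
Proof.
rewrite !(mass_reachesE (R := R)) -ltNge -[e.+1%:R]natr1 mulrDl mul1r => h1 h2.
by rewrite ltrBlDr addrC (lt_le_trans h2) // lerD2r.
Qed.

(** * Binary digits and elementary inequalities *)

Lemma truncn_divn {R : realType} (x : R) d : 0 <= x -> (0 < d)%N ->
  Num.truncn (x / d%:R) = (Num.truncn x %/ d)%N.
Proof.
move=> x0 d0; apply: truncn_def; have d0' : (0 : R) < d%:R by rewrite ltr0n.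
rewrite ler_pdivlMr // ltr_pdivrMr // -!natrM; apply/andP; split.
  by rewrite -truncn_ge_nat // leq_divM.
by rewrite -truncn_lt_nat // ltn_ceil.
Qed.

Lemma restr_digits {R : realType} (x : R) n : 0 <= x -> x < 1 ->
  str2nat (restr x n) = digits n (Num.truncn (2 ^+ n * x)).
Proof.
move=> x0 x1; apply: digits_str2nat => i hi.
have fx : Num.floor x = 0 by apply: floor_def; rewrite x0.
rewrite /bit fx subr0 -truncn_divn ?expn_gt0 ?mulr_ge0 ?exprn_ge0 //.
have -> : 2 ^+ n * x / (2 ^ (n - i.+1))%:R = x * 2 ^+ i.+1.
  have nz : (2 ^ (n - i.+1))%:R != 0 :> R by rewrite natrX expf_neq0.
  by apply: (canLR (mulfK nz)); rewrite natrX -mulrA -exprD subnKC // mulrC.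
by rewrite truncn_floor mulr_ge0 ?exprn_ge0.
Qed.

Lemma output_digits {R : realType} (u v : nat -> nat) B r y j K
    (t := (u j)%:R / (v j).+1%:R : R) :
  output u v B r y j K =
    digits (B * K + r) (Num.truncn (2 ^+ (B * K + r) * t) - y).
Proof.
rewrite /output /t mulrA truncn_divn // ?mulr_ge0 ?exprn_ge0 //.
by rewrite -natrX -natrM natrK.
Qed.

Lemma exp2_small {R : realType} (e : R) : 0 < e -> exists N, forall n, (N <= n)%N -> 2 ^- n <= e.
Proof.
move=> e0; exists (Num.truncn e^-1).+1 => n hn.
rewrite invf_ple ?posrE ?exprn_gt0 //.
apply: le_trans (ltW (truncnS_gt _)) _.
by rewrite -natrX ler_nat (leq_trans hn) // ltnW // ltn_expl.
Qed.

Lemma weight_le_exp2 {R : realType} m n (x : R) : 0 < x -> n%:R * x <= m%:R ->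
  weight m x <= 2 ^- n.
Proof.
move=> x0 h; rewrite /weight -[2 ^+ n]powR_mulrn // -powRN ler_powR ?ler1n //.
by rewrite mulNr lerN2 ler_pdivlMr.
Qed.

(* From k/x - k/y <= d one recovers y - x = x y (1/x - 1/y). *)
Lemma inv_gap {R : realType} (x y k d : R) : 0 < x -> x < 1 -> x <= y -> 0 < k ->
  k * (x^-1 - y^-1) <= d -> d <= k / (2 * x) -> y - x <= 2 * d / k.
Proof.
move=> x0 x1 xy k0 h1 h2; have y0 := lt_le_trans x0 xy.
have h3 : x^-1 - y^-1 <= d / k by rewrite ler_pdivlMr // mulrC.
have h4 : d / k <= (2 * x)^-1 by rewrite ler_pdivrMr // mulrC.
have y2 : y <= 2 * x.
  rewrite -lef_pV2 ?posrE ?mulr_gt0 //.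
  have := le_trans h3 h4; rewrite invfM; lra.
have -> : y - x = (y * x) * (x^-1 - y^-1).
  by field; rewrite !gt_eqF.
have dk0 : 0 <= d / k by apply: le_trans h3; rewrite subr_ge0 lef_pV2.
apply: (@le_trans _ _ (y * x * (d / k))); first by rewrite ler_wpM2l // mulr_ge0 ?ltW.
rewrite -[leRHS]mulrA ler_wpM2r //; apply: (@le_trans _ _ (2 * x * x)).
  by rewrite ler_wpM2r // ltW.
by rewrite -mulrA ler_piMr // mulr_ile1 // ltW.
Qed.

(** * Correctness of the decoder *)

Lemma decoding_exists {R : realType} V F (T theta : R) (u v a b c : nat -> nat) B B' :
  optimal V -> approximates 1 V F -> 0 < T -> T < 1 -> Theta V T = theta%:E ->
  (forall j, T <= (u j)%:R / (v j).+1%:R) ->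
  (u j)%:R / (v j).+1%:R @[j --> \oo] --> T ->
  (forall j, ((b j)%:R - (a j)%:R) / (c j).+1%:R <= theta) ->
  ((b j)%:R - (a j)%:R) / (c j).+1%:R @[j --> \oo] --> theta ->
  (0 < B')%N -> B'%:R * T <= B%:R ->
  exists Y K0, forall K r, (K0 <= K)%N -> (r < B')%N ->
    exists e k j y, [/\ (e < 2 ^ (B * K + 1))%N, least (mass_reaches F B K e) k,
      least (sum_below F u v a b c B' k K) j, (y < Y)%N &
      output u v B' r y j K = str2nat (restr T (B' * K + r))].
Proof.
move=> optV aF T0 T1 hTheta tge tcvg wle wcvg B'0 hB.
have pfV : prefix_free V by case: optV.
have [s0 hs0] := optimal_short optV.
pose t j : R := (u j)%:R / (v j).+1%:R.
(* The lower bound on the slope given by [partial_theta_slope] for the string [s0]. *)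
pose kappa : R := weight (codelen s0) T * ((codelen s0)%:R * ln 2).
have kappa0 : 0 < kappa.
  rewrite mulr_gt0 ?weight_gt0 // mulr_gt0 ?ln_gt0 ?ltr1n // ltr0n.
  by case: hs0 => p _; case: (codelen s0).
(* Beyond [N0] the error 3 * 2^-n meets the smallness condition of [inv_gap]. *)
have [N0 hN0] : exists N, forall n, (N <= n)%N -> 2 ^- n <= kappa / (2 * T) / 3.
  by apply: exp2_small; rewrite !divr_gt0 // mulr_gt0.
have u0 j : (0 < u j)%N.
  rewrite lt0n; apply/eqP => uj0; have := tge j.
  by rewrite uj0 mul0r leNgt T0.
(* Since t_j - T is at most 6/kappa * 2^-(B' K) and r < B', scaling by 2^n bounds the difference by
   6/kappa * 2^B'; the two successors absorb the rounding. *)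
exists (Num.truncn (6 / kappa * 2 ^+ B')).+2, (maxn N0 (codelen s0)) => K r.
rewrite geq_max => /andP[hK1 hK2] hr.
have B0 : (0 < B)%N by rewrite -(ltr0n R) (lt_le_trans _ hB) // mulr_gt0 ?ltr0n.
have [e [he [k1 hk1] hmax]] := mass_stage B K pfV aF.
have [k hk] := least_exists hk1.
have hgap k' := stage_gap (R := R) hk.1 (hmax k').
(* A compressible string missed at stage [k] is longer than B K, whereas [K] is at least the length
   of [s0]. *)
have found_s0 : (s0 < k)%N && found F k s0.
  have [k2 hk2] := short_found aF hs0.
  apply/negPn/negP => hn; have := hk2 (maxn k k2) (leq_maxr _ _) => /andP[h1 h2].
  have : fresh F k (maxn k k2) s0 by rewrite /fresh h2.
  move=> /(fresh_codelen (leq_maxl _ _) (hgap _) h1); rewrite ltnNge.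
  by rewrite (leq_trans hK2) // leq_pmull.
(* The missed part is at most [weight (B * K) T], and B' T <= B turns this into 2^-(B' K). *)
have theta_le_k : theta <= partial_theta F k T + 2 ^- (B' * K).
  apply: (theta_le aF hTheta) => k'.
  apply: (@le_trans _ _ (partial_theta F (maxn k k') T)).
    rewrite -subr_ge0 partial_theta_fresh ?leq_maxr //.
    by apply: sumr_ge0 => s _; rewrite mulr_ge0 ?weight_ge0.
  apply: (le_trans (partial_theta_tail T0 T1 (leq_maxl k k') (hgap _))).
  rewrite lerD2l; apply: weight_le_exp2 => //.
  by rewrite !natrM mulrAC ler_wpM2r.
(* The limit over j of w_j + 2^-(B' K) - Theta_k(t_j) is positive, so the search for [j] ends. *)
have [j1 hj1] : exists j, sum_below F u v a b c B' k K j.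
  have hlt : 0 < theta + 2 ^- (B' * K) - partial_theta F k T.
    have := partial_theta_le k aF hTheta.
    have : (0 : R) < 2 ^- (B' * K) by rewrite invr_gt0 exprn_gt0.
    by lra.
  have hcv : ((b j)%:R - (a j)%:R) / (c j).+1%:R + 2 ^- (B' * K) - partial_theta F k (t j)
     @[j --> \oo] --> theta + 2 ^- (B' * K) - partial_theta F k T.
    apply: cvgB; last exact: partial_theta_cvg.
    by apply: cvgD => //; exact: cvg_cst.
  have [j _ hj] := cvgr_gt _ hcv _ hlt.
  exists j; rewrite (sum_belowP (R := R)).
  have /andP[h1 _] := approx_sum_bounds (R := R) F k (B' * K) v (u0 j).
  apply: (le_trans h1); have := hj j (leqnn j); rewrite /= subr_gt0 => /ltW.
  exact.
have [j hj] := least_exists hj1.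
(* Three errors of 2^-(B' K) add up: the rounding of the sum, the slack in the test for [j], and the
   mass missed by stage [k]. *)
have tgap : t j - T <= 6 / kappa * 2 ^- (B' * K).
  have -> : 6 / kappa * 2 ^- (B' * K) = 2 * (3 * 2 ^- (B' * K)) / kappa :> R.
    by field; rewrite expf_neq0 // gt_eqF.
  apply: inv_gap => //; first exact: tge.
    case/andP: found_s0 => h1 h2.
    apply: (le_trans (partial_theta_slope T0 (tge j : T <= t j) h1 h2)).
    have := hj.1; rewrite (sum_belowP (R := R)) => h3.
    have /andP[_] := approx_sum_bounds (R := R) F k (B' * K) v (u0 j).
    rewrite -[_ / (v j).+1%:R]/(t j); move: (wle j) theta_le_k h3.
    move: (_ / 2 ^+ (B' * K + k)) (partial_theta _ _ _) (partial_theta _ _ _) (_ / (c j).+1%:R).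
    by move=> *; lra.
  rewrite mulrC -ler_pdivlMr //; apply: hN0.
  by rewrite (leq_trans hK1) // leq_pmull.
set n := (B' * K + r)%N.
have tj : (Num.truncn (2 ^+ n * T) <= Num.truncn (2 ^+ n * t j))%N.
  by apply: le_truncn; rewrite ler_wpM2l ?exprn_ge0 //; exact: tge.
(* The correction is the exact difference of the integer parts, so subtracting it from that of 2^n
   t_j recovers that of 2^n T. *)
exists e, k, j, (Num.truncn (2 ^+ n * t j) - Num.truncn (2 ^+ n * T))%N; split=> //.
  set C := 6 / kappa * 2 ^+ B'.
  have hC : 2 ^+ n * t j <= 2 ^+ n * T + C.
    rewrite -lerBlDl -mulrBr; apply: (@le_trans _ _ (2 ^+ n * (6 / kappa * 2 ^- (B' * K)))).
      by rewrite ler_wpM2l ?exprn_ge0.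
    rewrite mulrCA ler_wpM2l ?divr_ge0 ?ltW // /n exprD mulrAC divff ?expf_neq0 // mul1r.
    by rewrite ltr_eXn2l ?ltr1n.
  rewrite ltn_subLR // -(ltr_nat R).
  apply: (@le_lt_trans _ _ (2 ^+ n * t j)).
    by rewrite truncn_le mulr_ge0 ?exprn_ge0 ?divr_ge0.
  apply: (le_lt_trans hC).
  rewrite -addSnnS natrD -natr1.
  have := truncnS_gt (2 ^+ n * T); have := truncnS_gt C.
  by rewrite -[(Num.truncn C).+1%:R]natr1; lra.
by rewrite (output_digits (R := R)) restr_digits ?ltW // subKn.
Qed.

(** * From the decoder to the bound on complexity *)

Lemma limn_esup_le {R : realType} (f : nat -> \bar R) (x : \bar R) N :
  (forall n, (N <= n)%N -> (f n <= x)%E) -> (limn_esup f <= x)%E.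
Proof.
move=> h; apply: (@le_trans _ _ (ereal_sup (f @` [set n | (N <= n)%N]))).
  by apply: ereal_inf_lbound; exists [set n | (N <= n)%N] => //; exists N.
by apply: ge_ereal_sup => _ [n hn <-]; apply: h.
Qed.

Lemma total_recursive_sub f g : total_recursive f -> total_recursive g ->
  recf 1 (fun l => (f (nth 0 l 0) - g (nth 0 l 0))%N).
Proof. by move=> /total_recursive_recf hf /total_recursive_recf hg; apply: recf_sub. Qed.

Lemma Hc_le {R : realType} U q s n : runs U q s -> (size q <= n)%N ->
  (Hc (R := R) U s <= (n%:R)%:E)%E.
Proof.
move=> hq hn; apply: (@le_trans _ _ ((size q)%:R)%:E); last by rewrite lee_fin ler_nat.
by apply: ereal_inf_lbound; exists q.
Qed.

(** Each pair of [r] and [y] has its own machine and its own overhead; the pairs are finitely many,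
    so one constant [d] serves. *)
Lemma short_programs (U : prog) F (u v a b c : nat -> nat) B B' Y :
  optimal U -> recf 2 F ->
  recf 1 (fun l => u (nth 0 l 0)) -> recf 1 (fun l => v (nth 0 l 0)) ->
  recf 1 (fun l => a (nth 0 l 0)) -> recf 1 (fun l => b (nth 0 l 0)) ->
  recf 1 (fun l => c (nth 0 l 0)) ->
  exists d, forall r y K e k j s, (r < B')%N -> (y < Y)%N ->
    (e < 2 ^ (B * K + 1))%N -> least (mass_reaches F B K e) k ->
    least (sum_below F u v a b c B' k K) j ->
    output u v B' r y j K = str2nat s ->
    exists2 q, runs U q s & (size q <= K * (1 + B) + d)%N.
Proof.
move=> [_ optU] hF hu hv ha hb hc.
have /choice[d hd] (ry : nat * nat) : exists d, forall K e k j s,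
    (e < 2 ^ (B * K + 1))%N -> least (mass_reaches F B K e) k ->
    least (sum_below F u v a b c B' k K) j ->
    output u v B' ry.1 ry.2 j K = str2nat s ->
    exists2 q, runs U q s & (size q <= K * (1 + B) + 2 + d)%N.
  have [D hD] := decoder B B' ry.1 ry.2 hF hu hv ha hb hc.
  have hL : recf 1 (fun l => (B * nth 0 l 0 + 1)%N).
    exact: (@recf_ex 1 (Add (Mul (Cst B) (Var 0)) (Cst 1))).
  have [C pfC hC] := header_machine (L := fun K => (B * K + 1)%N) D hL.
  have [d hd] := optU _ pfC; exists d => K e k j s he hk hj hs.
  have [p [sp hp]] := hC _ _ _ he (hD _ _ _ _ hk hj).
  rewrite hs in hp; have [q [hq sq]] := hd _ _ hp; exists q => //.
  by apply: leq_trans sq _; rewrite sp; lia.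
(* The 2 counts the 0 that ends the run of ones and the extra bit allotted to [e]. *)
exists (2 + \max_(r < B') \max_(y < Y) d (r : nat, y : nat))%N.
move=> r y K e k j s hr hy he hk hj hs.
have [q hq sq] := hd (r, y) K e k j s he hk hj hs; exists q => //.
apply: leq_trans sq _; rewrite -addnA !leq_add2l.
apply: leq_trans (leq_bigmax (Ordinal hr)).
exact: (leq_bigmax (F := fun y : 'I_Y => d (r, y : nat)) (Ordinal hy)).
Qed.

Theorem theorem12 (R : realType) (U V : prog) (T : R) :
  optimal U -> optimal V -> 0 < T -> T < 1 ->
  (exists theta : R, Theta V T = theta%:E /\ left_computable theta) ->
  right_computable T ->
  compressible U T T.
Proof.
move=> optU optV T0 T1 [theta [hTheta [a [b [c [ra rb rc wge wcvg]]]]]].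
move=> [a1 [b1 [c1 [ra1 rb1 rc1 tge tcvg]]]].
have [F aF] := approximates_exists V 1.
have rF : recf 2 F by case: aF.
pose u j := (a1 j - b1 j)%N.
(* The subtraction in [u] does not truncate, since the approximations of T are positive. *)
have uE j : (u j)%:R / (c1 j).+1%:R = rat_seq a1 b1 c1 j :> R.
  rewrite /rat_seq natrB // -(ler_nat R) -subr_ge0.
  have := lt_le_trans T0 (tge j); rewrite /rat_seq pmulr_lgt0 ?invr_gt0 ?ltr0n //.
  exact: ltW.
have wE j : ((b j)%:R - (a j)%:R) / (c j).+1%:R = - rat_seq a b c j :> R.
  by rewrite /rat_seq -mulNr opprB.
apply/lee_addgt0Pr => eps eps0; rewrite -EFinD.
(* With B <= B' T + 1 the rate (1 + B)/B' is at most T + 2/B', below T + eps/2. *)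
pose B' := (Num.truncn (4 / eps)).+1; pose B := (Num.truncn (B'%:R * T)).+1.
have hB' : 4 < B'%:R * eps by rewrite -ltr_pdivrMr //; apply: truncnS_gt.
have hB : B'%:R * T <= B%:R by apply/ltW/truncnS_gt.
have hB2 : B%:R <= B'%:R * T + 1 by rewrite -natr1 lerD2r truncn_le mulr_ge0 // ltW.
have [||||Y [K0 hdec]] := decoding_exists (u := u) (v := c1) (a := a) (b := b) (c := c)
  optV aF T0 T1 hTheta _ _ _ _ (ltn0Sn _ : (0 < B')%N) hB.
- by move=> j; rewrite uE.
- by under eq_fun do rewrite uE.
- by move=> j; rewrite wE lerNl.
- by under eq_fun do rewrite wE; rewrite -[theta]opprK; apply: cvgN.
have ru : recf 1 (fun l => u (nth 0%N l 0)) := total_recursive_sub ra1 rb1.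
have [d hd] := short_programs B B' Y optU rF ru
  (total_recursive_recf rc1) (total_recursive_recf ra) (total_recursive_recf rb)
  (total_recursive_recf rc).
(* The first bound makes the quotient of n by B' at least [K0]; the second makes [d] at most n
   eps/2. *)
apply: (@limn_esup_le _ _ _ (maxn (K0 * B') (Num.truncn (d%:R / (eps / 2))).+1)) => n'.
rewrite geq_max => /andP[hn1 hn2]; set n := n'.+1.
pose K := (n %/ B')%N; pose r := (n %% B')%N.
have hr : (r < B')%N by rewrite ltn_mod.
have hK : (K0 <= K)%N by rewrite leq_divRL // (leq_trans hn1).
have nE : (B' * K + r)%N = n by rewrite mulnC -divn_eq.
have [e [k [j [y [he hk hj hy]]]]] := hdec K r hK hr; rewrite nE => hs.
have [q hq sq] := hd _ _ _ _ _ _ _ hr hy he hk hj hs.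
apply: (@le_trans _ _ ((K * (1 + B) + d)%:R%:E * (n%:R^-1)%:E)%E).
  by apply: lee_wpmul2r; [rewrite lee_fin|exact: Hc_le hq sq].
rewrite -EFinM lee_fin ler_pdivrMr ?ltr0n // natrD natrM natrD.
have KB : B'%:R * K%:R <= n%:R :> R by rewrite -natrM ler_nat -nE leq_addr.
have dn : d%:R <= n%:R * (eps / 2).
  rewrite -ler_pdivrMr ?divr_gt0 //; apply: (le_trans (ltW (truncnS_gt _))).
  by rewrite ler_nat (leq_trans hn2).
have h1 : K%:R * (1%:R + B%:R) <= K%:R * (B'%:R * (T + eps / 2)).
  by rewrite ler_wpM2l //; lra.
have h2 : (B'%:R * K%:R) * (T + eps / 2) <= n%:R * (T + eps / 2).
  by rewrite ler_wpM2r // addr_ge0 ?divr_ge0 // ltW.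
(* In total K (1 + B) + d <= n (T + eps/2) + n eps/2. *)
move: h1 h2 dn; move: (n%:R : R) (K%:R : R) (B'%:R : R) => x z w *.
nra.
Qed.
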